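(* Let $\mathfrak{t}_{n,k}=C_0^n\prod_{i=1}^rC_i^{k_i}\prod_{j=1}^JA_j(n,k)!^{\epsilon_j}$ be a balanced hypergeometric term with Newton polytope $P_{\mathfrak{t}}$ compact with nonempty interior, and let $V_{\mathfrak{t}}(w)=\log C_0+\sum_{i=1}^rw_i\log C_i+\sum_{j=1}^J\epsilon_jA_j(w)\log A_j(w)$, viewed as an analytic function on the universal abelian cover $\varpi:\hat{\mathbb{C}}^r\to\mathbb{C}^r\setminus\mathcal{A}_{\mathfrak{t}}$, where $\mathcal{A}_{\mathfrak{t}}=\{w\in\mathbb{C}^r:\prod_jA_j(w)=0\}$. Then: (a) $\varpi^{-1}(X_{\mathfrak{t}})$ coincides with the set of critical points of $V_{\mathfrak{t}}$. (b) If $w$ is a critical point of $V_{\mathfrak{t}}$, then $$e^{-V_{\mathfrak{t}}(w)}=C_0^{-1}\prod_{j=1}^JA_j(w)^{-\epsilon_jv_0(A_j)}=C_0^{-1}\prod_{j:A_j(w)\ne0}A_j(w)^{-\epsilon_jv_0(A_j)}.$$ Thus $\mathrm{CV}_{\mathfrak{t}}$ coincides with the set $\{e^{-V}: V \text{ a critical value of } V_{\mathfrak{t}}\}$. (c) For every face $\Delta$ of $P_{\mathfrak{t}}$, $V_{(\mathfrak{t}|_\Delta)}=(V_{\mathfrak{t}})|_\Delta$. (d) $S_{\mathfrak{t}}$ is a finite subset of $\bar{\mathbb{Q}}$ and $K_{\mathfrak{t}}=\mathbb{Q}(S_{\mathfrak{t}})$ is a number field.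
   Context: $n\in\mathbb{N}$, $k\in\mathbb{Z}^r$; $C_i$ nonzero algebraic numbers, $\epsilon_j\in\{1,-1\}$, $A_j$ integral linear forms with $\sum_j\epsilon_jA_j=0$. For $A(n,k)=a_0n+\sum_ia_ik_i$: $v_i(A)=a_i$ ($i=0,\dots,r$), and $A(w)=a_0+\sum_ia_iw_i$. $P_{\mathfrak{t}}=\{w\in\mathbb{R}^r:A_j(w)\ge0\ \forall j\}$. Variational equations: $C_i\prod_{j}A_j(w)^{\epsilon_jv_i(A_j)}=1$, $i=1,\dots,r$; $X_{\mathfrak{t}}$ is the set of complex solutions ($X_{\mathfrak{t}}=\{0\}$ if $r=0$). $\mathrm{CV}_{\mathfrak{t}}=\{C_0^{-1}\prod_{j:A_j(w)\ne0}A_j(w)^{-\epsilon_jv_0(A_j)}:w\in X_{\mathfrak{t}}\}$. For a face $\Delta$ of $P_{\mathfrak{t}}$, $\mathfrak{t}|_\Delta$ is the balanced term obtained by substituting an integral affine parametrization of the lattice points of the cone over $\Delta$ into $\mathfrak{t}$, and $(V_{\mathfrak{t}})|_\Delta$ is $V_{\mathfrak{t}}$ composed with the corresponding parametrization of the affine span of $\Delta$. $S_{\mathfrak{t}}=\{0\}\cup\bigcup_{\Delta\text{ face of }P_{\mathfrak{t}}}\mathrm{CV}_{\mathfrak{t}|_\Delta}$.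
   Formalization: Critical points in (a) and critical values in (b) are taken for some determination of the log C_i; (c) reads V_{t|Δ} = d·(V_t)|_Δ, d the least positive n of a lattice point in the span of the cone over Δ; identically zero forms A_j are ignored in the arrangement. *)

(* Defs.v *)
From HB Require Import structures.
From mathcomp Require Import all_boot all_order all_algebra.
From mathcomp Require Import all_classical all_reals all_analysis.
From mathcomp Require Import complex.

Set Implicit Arguments.
Unset Strict Implicit.
Unset Printing Implicit Defensive.

Import Order.TTheory GRing.Theory Num.Theory.
Import numFieldNormedType.Exports.

Local Open Scope classical_set_scope.
Local Open Scope ring_scope.

(* R[i] packed as a numClosedFieldType: the topology and norm of
   mathcomp-analysis are keyed on the structure, not on the type complex R. *)
Definition CC (R : realType) : numClosedFieldType := R[i].

Definition cexp (R : realType) (z : CC R) : CC R :=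
  let: (a +i* b)%C := (z : R[i]) in
  ((expR a * cos b) +i* (expR a * sin b))%C.

Definition algebraic_number (R : realType) (z : CC R) : Prop :=
  algebraicOver (ratr : rat -> CC R) z.

(* Covering of an open subset B of X. The open sheets over U are the images of
   U under the sections s i. *)
Definition covering_map (E X : topologicalType) (B : set X) (p : E -> X) :
    Prop :=
  [/\ continuous p, range p = B &
    forall b, B b -> exists (U : set X) (I : Type) (s : I -> X -> E),
      [/\ open U, U b, U `<=` B &
        [/\ forall i x, U x -> {for x, continuous (s i)},
            forall i x, U x -> p (s i x) = x,
            forall i, open (s i @` U) &
            forall e, U (p e) -> exists! i, s i (p e) = e]]].

Definition deck_transformation (E X : topologicalType) (p : E -> X)
    (f : E -> E) : Prop :=
  [/\ continuous f, p \o f = p &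
    exists g : E -> E, [/\ continuous g, cancel f g & cancel g f]].

Definition abelian_cover (E X : topologicalType) (B : set X) (p : E -> X) :
    Prop :=
  [/\ covering_map B p, connected [set: E],
      forall e e', p e = p e' -> exists2 f, deck_transformation p f & f e = e' &
      forall f g, deck_transformation p f -> deck_transformation p g ->
        f \o g = g \o f].

Definition universal_abelian_cover (E X : topologicalType) (B : set X)
    (p : E -> X) : Prop :=
  abelian_cover B p /\
  forall (E' : topologicalType) (p' : E' -> X), abelian_cover B p' ->
    forall e e', p e = p' e' ->
      exists h : E -> E', [/\ continuous h, p' \o h = p & h e = e'].

(* E carries the complex structure lifted from C^r, so the differential of V at
   e is read through a local section s of p; the germ of s at p e is unique. *)
Definition critical_point (R : realType) (r : nat) (E : topologicalType)
    (p : E -> 'rV[CC R]_r) (V : E -> CC R) (e : E) : Prop :=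
  exists s : 'rV[CC R]_r -> E,
    [/\ s (p e) = e, {for p e, continuous s},
        \forall w \near p e, p (s w) = w &
        is_diff (p e) (V \o s) (fun=> 0)].

(* The data of C_0^n prod_i C_i^{k_i} prod_j A_j(n,k)!^{eps_j}. Index 0 of
   'I_r.+1 belongs to n and index i+1 (lift ord0 i) to k_i. *)
Record hyp_term (R : realType) (r : nat) := HypTerm {
  tJ : nat;
  tC : 'I_r.+1 -> CC R;
  tA : 'I_tJ -> 'rV[int]_r.+1;
  teps : 'I_tJ -> int
}.
Arguments tC {R r} _ _.
Arguments tA {R r} _ _.
Arguments teps {R r} _ _.

Definition balanced (R : realType) (r : nat) (t : hyp_term R r) : Prop :=
  [/\ forall i, tC t i != 0,
      forall i, algebraic_number (tC t i),
      forall j, teps t j = 1 \/ teps t j = -1 &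
      \sum_j teps t j *: tA t j = 0].

Definition vcoef (r : nat) (i : 'I_r.+1) (A : 'rV[int]_r.+1) : int := A 0 i.

(* A(w) = a_0 + sum_i a_i w_i *)
Definition dehom (F : pzRingType) (r : nat) (A : 'rV[int]_r.+1)
    (w : 'rV[F]_r) : F :=
  (vcoef ord0 A)%:~R + \sum_(i < r) (vcoef (lift ord0 i) A)%:~R * w 0 i.

(* The value at (n,k) = x; meaningful when all A_j(x) >= 0. *)
Definition term_val (R : realType) (r : nat) (t : hyp_term R r)
    (x : 'rV[int]_r.+1) : CC R :=
  (\prod_i tC t i ^ x 0 i) *
  \prod_j (absz ((x *m (tA t j)^T) 0 0))`!%:R ^ teps t j.

Definition newton_polytope (R : realType) (r : nat) (t : hyp_term R r) :
    set 'rV[R]_r :=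
  [set w | forall j, 0 <= dehom (tA t j) w].

(* Identically zero forms contribute the constant factor 0! = 1 (and 0 log 0 = 0
   to the potential) and define no hyperplane. They occur in every restriction
   to a proper face. *)
Definition arrangement (R : realType) (r : nat) (t : hyp_term R r) :
    set 'rV[CC R]_r :=
  [set w | exists2 j, tA t j != 0 & dehom (tA t j) w = 0].

(* Since 0 ^ m = 0 for every nonzero m : int, including m < 0, points at which
   a factor with nonzero exponent vanishes are not solutions. *)
Definition variational_solutions (R : realType) (r : nat) (t : hyp_term R r) :
    set 'rV[CC R]_r :=
  [set w | forall i : 'I_r,
    tC t (lift ord0 i) *
    \prod_j dehom (tA t j) w ^ (teps t j * vcoef (lift ord0 i) (tA t j)) = 1].

Definition CV (R : realType) (r : nat) (t : hyp_term R r) : set (CC R) :=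
  [set (tC t ord0)^-1 *
    \prod_(j | dehom (tA t j) w != 0)
      dehom (tA t j) w ^ (- (teps t j * vcoef ord0 (tA t j)))
  | w in variational_solutions t].

(* lC i and lA j stand for log C_i and log A_j(w). *)
Definition potential (R : realType) (r : nat) (t : hyp_term R r)
    (lC : 'I_r.+1 -> CC R) (lA : 'I_(tJ t) -> CC R) (w : 'rV[CC R]_r) : CC R :=
  lC ord0 + \sum_(i < r) w 0 i * lC (lift ord0 i) +
  \sum_j (teps t j)%:~R * dehom (tA t j) w * lA j.
Arguments potential {R r} t lC lA w.

(* Any determination of the logs is allowed: a point over X_t satisfies
   log C_i + sum_j eps_j v_i(A_j) log A_j(w) in 2 pi i Z, and is critical for V_t
   only after a suitable choice of log C_1, ..., log C_r. *)
Definition log_constants (R : realType) (r : nat) (t : hyp_term R r)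
    (lC : 'I_r.+1 -> CC R) : Prop :=
  forall i, cexp (lC i) = tC t i.

(* Branches of log A_j(f(e)) on E. Where A_j(f(e)) = 0 the value of lA j e is
   irrelevant, as it is multiplied by A_j(f(e)) in the potential. *)
Definition log_branches (R : realType) (r : nat) (t : hyp_term R r)
    (E : topologicalType) (f : E -> 'rV[CC R]_r)
    (lA : 'I_(tJ t) -> E -> CC R) : Prop :=
  forall j, continuous (lA j) /\
    forall e, dehom (tA t j) (f e) != 0 ->
      cexp (lA j e) = dehom (tA t j) (f e).
Arguments log_branches {R r} t {E} f lA.

(* V_t pulled back along f : E -> C^r. *)
Definition lifted_potential (R : realType) (r : nat) (t : hyp_term R r)
    (E : topologicalType) (f : E -> 'rV[CC R]_r) (lC : 'I_r.+1 -> CC R)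
    (lA : 'I_(tJ t) -> E -> CC R) : E -> CC R :=
  fun e => potential t lC (lA ^~ e) (f e).
Arguments lifted_potential {R r} t {E} f lC lA e.

Definition potential_branches (R : realType) (r : nat) (t : hyp_term R r)
    (E : topologicalType) (f : E -> 'rV[CC R]_r) (lC : 'I_r.+1 -> CC R) :
    set (E -> CC R) :=
  [set lifted_potential t f lC lA | lA in log_branches t f].
Arguments potential_branches {R r} t {E} f lC.

Definition is_face (R : realType) (r : nat) (P D : set 'rV[R]_r) : Prop :=
  D !=set0 /\
  exists (c : 'rV[R]_r) (b : R),
    let f (w : 'rV[R]_r) := \sum_i c 0 i * w 0 i in
    (forall w, P w -> f w <= b) /\ D = P `&` [set w | f w = b].

Definition homog (F : pzRingType) (r : nat) (w : 'rV[F]_r) : 'rV[F]_r.+1 :=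
  row_mx (1%:M : 'rV[F]_1) w.

(* Linear span in R^{1+r} of the cone {(n, n w) : n >= 0, w in D}. *)
Definition cone_span (R : realType) (r : nat) (D : set 'rV[R]_r) :
    set 'rV[R]_r.+1 :=
  [set x | exists (N : nat) (c : 'I_N -> R) (w : 'I_N -> 'rV[R]_r),
    (forall i, D (w i)) /\ x = \sum_i c i *: homog (w i)].

(* x' |-> x' *m phi is a parametrization (n', k') |-> (n, k) = (d n', n' p + k' B)
   of the lattice spanned by the lattice points of the cone over D, with
   d = phi 0 0; d = 1 exactly when the affine span of D contains a point of Z^r. *)
Definition face_param (R : realType) (r s : nat) (D : set 'rV[R]_r)
    (phi : 'M[int]_(s.+1, r.+1)) : Prop :=
  [/\ 0 < phi ord0 ord0,
      forall l : 'I_s, phi (lift ord0 l) ord0 = 0,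
      injective (fun x : 'rV[int]_s.+1 => x *m phi) &
      forall y : 'rV[int]_r.+1,
        cone_span D (map_mx intr y) <-> exists x, y = x *m phi].

(* The parametrization w' |-> (p + w' B) / d of the affine span of D. *)
Definition affine_param (F : fieldType) (r s : nat)
    (phi : 'M[int]_(s.+1, r.+1)) (w : 'rV[F]_s) : 'rV[F]_r :=
  \row_i (dehom (col (lift ord0 i) phi)^T w / (phi ord0 ord0)%:~R).

Definition restrict_term (R : realType) (r s : nat) (t : hyp_term R r)
    (phi : 'M[int]_(s.+1, r.+1)) : hyp_term R s :=
  {| tC := fun l => \prod_i tC t i ^ phi l i;
     tA := fun j => tA t j *m phi^T;
     teps := teps t |}.

Definition restrict_logs (R : realType) (r s : nat)
    (phi : 'M[int]_(s.+1, r.+1)) (lC : 'I_r.+1 -> CC R) : 'I_s.+1 -> CC R :=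
  fun l => \sum_i (phi l i)%:~R * lC i.

Lemma term_val_restrict (R : realType) (r s : nat) (t : hyp_term R r)
    (phi : 'M[int]_(s.+1, r.+1)) (x : 'rV[int]_s.+1) :
  (forall i, tC t i != 0) ->
  term_val (restrict_term t phi) x = term_val t (x *m phi).
Proof.
move=> C0; rewrite /term_val /=; congr (_ * _); last first.
  by apply: eq_bigr => j _; rewrite trmx_mul trmxK mulmxA.
transitivity (\prod_(l < s.+1) \prod_(i < r.+1) tC t i ^ (x 0 l * phi l i)).
  apply: eq_bigr => l _; 
  rewrite (big_morph (fun a => a ^ x 0 l) (fun a b => expfzMl a b _) (exp1rz _ _)).
  by apply: eq_bigr => i _; rewrite exprz_exp mulrC.
rewrite exchange_big; apply: eq_bigr => i _; rewrite mxE.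
by rewrite (big_morph _ (fun a b => expfzDr a b (C0 i)) (expr0z _)).
Qed.

Lemma balanced_restrict (R : realType) (r s : nat) (t : hyp_term R r)
    (phi : 'M[int]_(s.+1, r.+1)) :
  balanced t -> balanced (restrict_term t phi).
Proof.
case=> C0 Calg eps1 bal; split => //=.
- by move=> l; rewrite prodf_seq_neq0; apply/allP => i _ /=; rewrite expfz_neq0.
- move=> l; apply: (big_ind (@algebraic_number R)).
  + exact: algebraic1.
  + by move=> a b; apply: algebraic_mul.
  + move=> i _.
    have pw n : algebraic_number (tC t i ^+ n).
      elim: n => [|n IHn]; first exact: algebraic1.
      rewrite exprS; exact: algebraic_mul (Calg i) IHn.
    by case: (phi l i) => n; [exact: pw | apply: algebraic_inv; exact: pw].
- transitivity ((\sum_j teps t j *: tA t j) *m phi^T); last by rewrite bal mul0mx.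
  by rewrite mulmx_suml; apply: eq_bigr => j _; rewrite scalemxAl.
Qed.

Definition S_set (R : realType) (r : nat) (t : hyp_term R r) : set (CC R) :=
  [set 0] `|`
  [set z | exists (D : set 'rV[R]_r) (s : nat) (phi : 'M[int]_(s.+1, r.+1)),
    [/\ is_face (newton_polytope t) D, face_param D phi &
        CV (restrict_term t phi) z]].

Definition is_subfield (F : fieldType) (K : set F) : Prop :=
  [/\ K 1, forall x y, K x -> K y -> K (x - y) &
      forall x y, K x -> K y -> K (x / y)].

Definition generated_field (F : fieldType) (S : set F) : set F :=
  [set z | forall K : set F, is_subfield K -> S `<=` K -> K z].

Definition number_field (R : realType) (K : set (CC R)) : Prop :=
  is_subfield K /\
  exists (n : nat) (b : 'I_n -> CC R),
    forall z, K z -> exists q : 'I_n -> rat, z = \sum_i ratr (q i) * b i.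

(* Main.v *)
(* A continuous branch of log f is differentiable wherever f is, with
   differential df / f. Hence the differential of V_t in a local section of the
   cover is sum_i l_i dw_i, where
     l_i = log C_i + sum_j eps_j v_i(A_j) log A_j(w):
   the extra term sum_j eps_j dA_j vanishes because t is balanced.
   Exponentiating l_i = 0 for i > 0 gives the variational equations, and
   Euler's relation V_t = l_0 + sum_i w_i l_i gives the critical values
   exp(-l_0).

   For (d), let z be a value attained at w in X_t. If z were transcendental,
   there would be a derivation D of C, trivial on algebraic numbers, such that
   D z = 1; but taking logarithmic derivatives of the variational equations,
   Euler's relation yields D z = 0. Hence every value is algebraic. On the other
   hand CV_t is constructible, so by quantifier elimination it is finite or
   cofinite, and a cofinite set contains transcendental numbers. Finally, a
   face of the polytope is determined by its set of active forms, and two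
   parametrizations of one face differ by a unimodular matrix, which does not
   change CV. *)

Require Import Defs.
From HB Require Import structures.
From mathcomp Require Import all_boot all_order all_algebra.
From mathcomp Require Import separable fieldext closed_field.
From mathcomp Require Import all_classical all_reals all_analysis.
From mathcomp Require Import complex.
From mathcomp Require Import ring lra zify.
Import Order.TTheory GRing.Theory Num.Theory.
Import numFieldNormedType.Exports.
Local Open Scope classical_set_scope.
Local Open Scope ring_scope.

Set Implicit Arguments.
Unset Strict Implicit.
Unset Printing Implicit Defensive.

(** * Differentials *)

Section DifferentialTheory.
Context {K : numFieldType} {V W : normedModType K}.

Lemma is_diff_approxP (f : V -> W) (l : {linear V -> W}) (x : V) :
  continuous l ->
  is_diff x f l <->
  forall e, 0 < e ->
    \forall h \near (0 : V), `|f (h + x) - f x - l h| <= e * `|h|.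
Proof.
move=> l_cont; split=> [[fx dfE] e e0|approx].
  have /eqaddoP/(_ e e0) := diff_locally fx.
  by apply: filterS => h /=; rewrite dfE -addrA -opprD.
have expansion : f \o shift x = cst (f x) + l +o_ 0 id.
  apply/eqaddoP => e /approx; apply: filterS => h /=.
  by rewrite -addrA -opprD.
have dE := diff_unique l_cont expansion.
by split=> //; apply/diff_locallyP; rewrite dE.
Qed.

Lemma is_diff_approx (f df : V -> W) (x : V) : is_diff x f df ->
  forall e, 0 < e ->
    \forall h \near (0 : V), `|f (h + x) - f x - df h| <= e * `|h|.
Proof.
case=> fx <-; apply/(@is_diff_approxP f _ x); first exact: diff_continuous.
exact: differentiableP.
Qed.

Lemma is_diff_unique (f df dg : V -> W) (x : V) :
  is_diff x f df -> is_diff x f dg -> df = dg.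
Proof. by case=> _ <- [_ <-]. Qed.

Lemma near_eq_is_diff (f g dg : V -> W) (x : V) :
  (\forall y \near x, f y = g y) -> is_diff x g dg -> is_diff x f dg.
Proof.
move=> fg gx; have [g_diff dgE] := gx.
rewrite -dgE; apply/is_diff_approxP => [|e e0]; first exact: diff_continuous.
have fgx : f x = g x := nbhs_singleton fg.
move: fg; rewrite (near_shift 0) dgE => fg.
apply: filterS2 fg (is_diff_approx gx e0) => h /=.
by rewrite subr0 fgx => ->.
Qed.

Lemma is_diff_sum (I : finType) (f df : I -> V -> W) (x : V) :
  (forall i, is_diff x (f i) (df i)) ->
  is_diff x (fun y => \sum_i f i y) (fun y => \sum_i df i y).
Proof.
move=> fx; rewrite -!fct_sumE.
elim/big_ind2: _ => // [|g dg h dh gx hx]; first exact: is_diff_cst.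
exact: is_diffD.
Qed.

End DifferentialTheory.

Lemma is_diff_coord (K : numFieldType) (r : nat) (x : 'rV[K]_r) (i : 'I_r) :
  is_diff x (fun w : 'rV[K]_r => w 0 i : K) (fun w : 'rV[K]_r => w 0 i : K).
Proof.
have coord_linear : linear (fun w : 'rV[K]_r => w 0 i : K).
  by move=> a u v; rewrite !mxE.
pose coord : {linear 'rV[K]_r -> K} := HB.pack (fun w : 'rV[K]_r => w 0 i : K)
  (GRing.isLinear.Build _ _ _ _ _ coord_linear).
apply/(@is_diff_approxP _ _ _ _ coord); first exact: coord_continuous.
move=> e e0; near=> h; rewrite /= mxE addrK subrr normr0 mulr_ge0 // ltW //.
Unshelve. all: by end_near. Qed.

Section DerivativeTheory.
Context {K : numFieldType}.
Implicit Types (g : K -> K) (a d : K).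

Lemma is_derive1_is_diff g a d :
  is_derive a 1 g d <-> is_diff a g ( *:%R d).
Proof.
have -> : ( *:%R d : K -> K) = *:%R^~ d by apply/funext => h; exact: mulrC.
split=> [[ga <-]|[ga dgE]].
  by split; [exact/derivable1_diffP | rewrite deriv1E // derive1E].
split; first exact/derivable1_diffP.
by rewrite deriveE // dgE /= scale1r.
Qed.

Lemma is_derive1_approxP g a d :
  is_derive a 1 g d <->
  forall e, 0 < e ->
    \forall h \near (0 : K), `|g (h + a) - g a - d * h| <= e * `|h|.
Proof.
apply: iff_trans (is_derive1_is_diff g a d) _.
exact: (@is_diff_approxP _ _ _ g ( *:%R d) a (@scaler_continuous _ K d)).
Qed.

End DerivativeTheory.

Section DifferentialOfLift.
Context {K : numFieldType} {V : normedModType K}.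
Variables (g : K -> K) (d : K) (f df L : V -> K) (x : V).
Hypothesis gLx : is_derive (L x) 1 g d.
Hypothesis d_neq0 : d != 0.
Hypothesis fx : is_diff x f df.
Hypothesis Lx : {for x, continuous L}.
Hypothesis gL : \forall y \near x, g (L y) = f y.

Let increment (h : V) : K := L (h + x) - L x.

Let increment_near (e : K) : 0 < e ->
  \forall h \near 0,
    `|d * increment h - df h| <= e * `|increment h| + e * `|h|.
Proof.
move=> e0.
have increment_cvg0 : increment h @[h --> 0] --> 0.
  rewrite -(subrr (L x)); apply: cvgB; last exact: cvg_cst.
  by rewrite -[X in _ --> X]/(L x) (cvg_comp_shift x 0 L) add0r.
have gLE : \forall h \near 0,
    g (increment h + L x) - g (L x) = f (h + x) - f x.
  have gLx0 : g (L x) = f x := nbhs_singleton gL.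
  move: gL; rewrite (near_shift 0); apply: filterS => h /=.
  by rewrite subr0 gLx0 /increment subrK => ->.
have := increment_cvg0 _ ((is_derive1_approxP _ _ _).1 gLx e e0).
apply: filterS3 gLE (is_diff_approx fx e0) => h gLh fh /= gh.
set dh := d * _; rewrite -gLh in fh.
rewrite [dh - _](_ : _ = (g (increment h + L x) - g (L x) - df h) -
  (g (increment h + L x) - g (L x) - dh)); last by ring.
by rewrite (le_trans (ler_normB _ _)) // addrC lerD.
Qed.

Let increment_lipschitz :
  exists2 M, 0 < M & \forall h \near 0, `|increment h| <= M * `|h|.
Proof.
have [k k_gt0 df_le] : exists2 k : K, 0 < k & forall h, `|df h| <= k * `|h|.
  case: fx => f_diff <-; apply: linear_lipschitz.
  exact: diff_continuous.
have d2_gt0 : 0 < `|d| / 2 by rewrite divr_gt0 ?normr_gt0.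
exists ((k + `|d| / 2) / (`|d| / 2)); first by rewrite divr_gt0 // addr_gt0.
apply: filterS (increment_near d2_gt0) => h near_h.
rewrite mulrAC ler_pdivlMr // mulrC -(lerD2l (`|d| / 2 * `|increment h|)).
rewrite -mulrDl -splitr -normrM -[d * _](subrK (df h)).
rewrite (le_trans (ler_normD _ _)) // mulrDl.
rewrite (le_trans (lerD near_h (df_le h))) //.
by rewrite -addrA lerD2l addrC.
Qed.

(* The expansion of g at L x bounds the increment of L by a multiple of h, so
   that its remainder is o(h). *)
Lemma is_diff_lift : is_diff x L (fun h => d^-1 * df h).
Proof.
have [M M_gt0 increment_le] := increment_lipschitz.
have [f_diff dfE] := fx.
have -> : (fun h => d^-1 * df h) = d^-1 \*: 'd f x by rewrite dfE.
apply/is_diff_approxP => [y|e e0].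
  apply: (@continuous_comp _ _ _ ('d f x) ( *:%R d^-1)).
    exact: diff_continuous.
  exact: scaler_continuous.
pose c := e * `|d| / (M + 1).
have ed_gt0 : 0 < e * `|d| by rewrite mulr_gt0 ?normr_gt0.
have c_gt0 : 0 < c by rewrite divr_gt0 // addr_gt0.
apply: filterS2 increment_le (increment_near c_gt0) => h le_h near_h.
rewrite /= dfE -/(increment h) -[increment h](mulKf d_neq0) -mulrBr normrM.
rewrite normfV ler_pdivrMl ?normr_gt0 //.
apply: (le_trans near_h); rewrite -mulrDr /c mulrAC ler_pdivrMr ?addr_gt0 //.
rewrite [`|d| * _]mulrCA mulrA -[leRHS]mulrA; apply: ler_wpM2l;
  first exact: ltW.
by rewrite mulrDr mulr1 mulrC lerD2r.
Qed.

End DifferentialOfLift.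

(** * The complex exponential *)

Section ComplexExponential.
Context {R : realType}.
Implicit Types (x y z u : CC R) (a b : R).

Lemma cexpD x y : cexp (x + y) = cexp x * cexp y.
Proof.
case: x y => [a b] [c d]; rewrite /cexp /= expRD cosD sinD.
by apply/eqP; rewrite eq_complex /=; apply/andP; split; apply/eqP; ring.
Qed.

Lemma cexp0 : cexp (0 : CC R) = 1.
Proof. by rewrite /cexp /= expR0 cos0 sin0 mul1r mulr0. Qed.

Lemma cexpxMcexpNx x : cexp x * cexp (- x) = 1.
Proof. by rewrite -cexpD addrN cexp0. Qed.

Lemma cexp_neq0 x : cexp x != 0.
Proof.
by apply: contra_eq_neq (cexpxMcexpNx x) => ->; rewrite mul0r eq_sym oner_eq0.
Qed.

Lemma cexpN x : cexp (- x) = (cexp x)^-1.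
Proof. by rewrite -[LHS](mulKf (cexp_neq0 x)) cexpxMcexpNx mulr1. Qed.

Lemma cexp_sum (I : Type) (s : seq I) (P : pred I) (F : I -> CC R) :
  cexp (\sum_(i <- s | P i) F i) = \prod_(i <- s | P i) cexp (F i).
Proof. exact: (big_morph _ cexpD cexp0). Qed.

Lemma cexpMz (m : int) x : cexp (m%:~R * x) = cexp x ^ m.
Proof.
have cexpMn n : cexp (n%:R * x) = cexp x ^+ n.
  elim: n => [|n IHn]; first by rewrite mul0r cexp0.
  by rewrite -natr1 mulrDl mul1r cexpD IHn exprSr.
case: m => n; first exact: cexpMn.
by rewrite NegzE mulrNz mulNr cexpN -pmulrn cexpMn exprnN.
Qed.

Lemma cos_sin_surj a b : a ^+ 2 + b ^+ 2 = 1 ->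
    exists t, cos t = a /\ sin t = b.
Proof.
move=> ab1; have a1 : -1 <= a <= 1 by apply/andP; split; nra.
have sin_acos_a : sin (acos a) = `|b|.
  by rewrite sin_acos // -ab1 addrAC subrr add0r sqrtr_sqr.
have [b_ge0|b_lt0] := leP 0 b.
  by exists (acos a); rewrite acosK // sin_acos_a ger0_norm.
by exists (- acos a); rewrite cosN sinN acosK // sin_acos_a ltr0_norm ?opprK.
Qed.

Lemma cexp_surj z : z != 0 -> exists x, cexp x = z.
Proof.
case: z => [a b] z0; pose rho := Num.sqrt (a ^+ 2 + b ^+ 2).
have rho2 : rho ^+ 2 = a ^+ 2 + b ^+ 2.
  by rewrite sqr_sqrtr // addr_ge0 ?sqr_ge0.
have rho_neq0 : rho != 0.
  rewrite -sqrf_eq0 rho2 paddr_eq0 ?sqr_ge0 // !sqrf_eq0.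
  by move: z0; rewrite eq_complex.
have rho_gt0 : 0 < rho by rewrite lt_neqAle eq_sym rho_neq0 sqrtr_ge0.
have [|t [cos_t sin_t]] := @cos_sin_surj (a / rho) (b / rho).
  by rewrite !exprMn -mulrDl -rho2 -exprMn divff // expr1n.
exists (ln rho +i* t)%C.
by rewrite /cexp /= lnK // cos_t sin_t !(mulrC rho) !divfK.
Qed.

Lemma normc_ge_Im z : `|complex.Im z|%:C%C <= `|z|.
Proof. by rewrite normc_def lecR -sqrtr_sqr ler_wsqrtr // lerDr sqr_ge0. Qed.

Lemma normc_le_ReDIm z : `|z| <= (`|complex.Re z| + `|complex.Im z|)%:C%C.
Proof.
rewrite normc_def lecR -(@ler_sqr _ (Num.sqrt _)) ?nnegrE ?sqrtr_ge0
  ?addr_ge0 //.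
rewrite sqr_sqrtr ?addr_ge0 ?sqr_ge0 // sqrrD !real_normK ?num_real //.
by rewrite lerD2r lerDl mulrn_wge0 // mulr_ge0.
Qed.

Lemma near0_ReIm (P : set R) : (\forall h \near (0 : R), P h) ->
  \forall u \near (0 : CC R), P (complex.Re u) /\ P (complex.Im u).
Proof.
move=> /(@nbhs_norm0P R R)[d /= d_gt0 Pd].
apply/(@nbhs_norm0P (CC R) (CC R)); exists d%:C%C; first by rewrite /= ltcR.
move=> u /= ud; split; apply: Pd; rewrite /= -ltcR; apply: le_lt_trans ud.
  exact: normc_ge_Re.
exact: normc_ge_Im.
Qed.

Let expR_cos_sin_near0 (e : R) : 0 < e ->
  \forall h \near (0 : R), [/\ `|expR h - 1 - h| <= e * `|h|,
    `|cos h - 1| <= e * `|h|, `|sin h - h| <= e * `|h| & `|expR h - 1| <= e].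
Proof.
move=> e_gt0.
have expR_near : \forall h \near (0 : R), `|expR 0 - expR h| <= e.
  exact: (@cvgr_dist_le _ _ _ _ _ _ _ (@continuous_expR R 0) e e_gt0).
have /is_derive1_approxP/(_ e e_gt0) expR_diff := is_derive_expR (0 : R).
have /is_derive1_approxP/(_ e e_gt0) cos_diff := is_derive_cos (0 : R).
have /is_derive1_approxP/(_ e e_gt0) sin_diff := is_derive_sin (0 : R).
move: expR_near expR_diff cos_diff sin_diff.
rewrite expR0 cos0 sin0 oppr0 => expR_near expR_diff cos_diff sin_diff.
apply: filterS2 (filterI expR_near expR_diff) (filterI cos_diff sin_diff) => h.
rewrite /= ?addr0 mul1r mul0r !subr0 distrC.
by move=> [? ?] [? ?]; split.
Qed.

Lemma cexp_near0 (e : CC R) : 0 < e ->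
  \forall u \near (0 : CC R), `|cexp u - 1 - u| <= e * `|u|.
Proof.
move=> e_gt0.
have [c eE] : exists c, e = c%:C%C by exact/complex_realP/gtr0_real.
have c_gt0 : 0 < c by rewrite -ltcR -eE.
have c'_gt0 : 0 < Num.min 1 (c / 10) by rewrite lt_min ltr01 divr_gt0.
have := near0_ReIm (expR_cos_sin_near0 c'_gt0).
apply: filterS => -[a b] [] /= [expR_a _ _ expR_a1] [_ cos_b sin_b _].
have -> : cexp (a +i* b)%C - 1 - (a +i* b)%C =
    ((expR a * cos b - 1 - a) +i* (expR a * sin b - b))%C :> CC R.
  by apply/eqP; rewrite eq_complex /= oppr0 addr0 !eqxx.
set c' := Num.min _ _ in c'_gt0 expR_a expR_a1 cos_b sin_b.
have [c'1 c'c] : c' <= 1 /\ c' <= c / 10 by split; rewrite ge_min lexx ?orbT.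
have expR_a2 : `|expR a| <= 2.
  by rewrite -[expR a](subrK 1) (le_trans (ler_normD _ _)) // normr1; lra.
have Re_le : `|expR a * cos b - 1 - a| <= c' * `|a| + 2 * (c' * `|b|).
  have -> : expR a * cos b - 1 - a = (expR a - 1 - a) + expR a * (cos b - 1).
    by ring.
  by rewrite (le_trans (ler_normD _ _)) // lerD // normrM ler_pM.
have Im_le : `|expR a * sin b - b| <= 2 * (c' * `|b|) + c' * `|b|.
  have -> : expR a * sin b - b = expR a * (sin b - b) + (expR a - 1) * b.
    by ring.
  by rewrite (le_trans (ler_normD _ _)) // lerD // normrM ler_pM.
have ab_le : (`|a| + `|b|)%:C%C <= 2 * `|(a +i* b)%C : CC R|.
  rewrite (rmorphD (real_complex R)) mulr2n mulrDl !mul1r lerD //.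
    exact: normc_ge_Re (a +i* b)%C.
  exact: normc_ge_Im (a +i* b)%C.
apply: le_trans (normc_le_ReDIm _) _ => /=.
apply: (@le_trans _ _ (c / 2 * (`|a| + `|b|))%:C%C).
  by rewrite lecR; have := normr_ge0 a; have := normr_ge0 b; nra.
have -> : e = (c / 2)%:C%C * 2.
  by rewrite -(rmorph_nat (real_complex R)) -(rmorphM (real_complex R)) divfK.
by rewrite (rmorphM (real_complex R)) -mulrA ler_wpM2l // ler0c divr_ge0 // ltW.
Qed.

Lemma is_derive_cexp z : is_derive z 1 (@cexp R) (cexp z).
Proof.
apply/is_derive1_approxP => e e_gt0.
have nz_gt0 : 0 < `|cexp z| by rewrite normr_gt0 cexp_neq0.
apply: filterS (cexp_near0 (divr_gt0 e_gt0 nz_gt0)) => h.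
rewrite cexpD mulrAC ler_pdivlMr // -normrM !mulrBl mul1r.
by rewrite [cexp z * h]mulrC.
Qed.

Lemma is_diff_log {V : normedModType (CC R)} (f df L : V -> CC R) (x : V) :
  is_diff x f df -> {for x, continuous L} ->
  (\forall y \near x, cexp (L y) = f y) ->
  is_diff x L (fun h => (f x)^-1 * df h).
Proof.
move=> fx Lx expL; rewrite -(nbhs_singleton expL).
exact: (@is_diff_lift _ _ _ _ _ _ L) (is_derive_cexp _) (cexp_neq0 _)
  fx Lx expL.
Qed.

Lemma is_diff_xlogx {V : normedModType (CC R)} (f df L : V -> CC R) (x : V) :
  is_diff x f df -> {for x, continuous L} ->
  (\forall y \near x, cexp (L y) = f y) ->
  is_diff x (f * L) (fun h => (1 + L x) * df h).
Proof.
move=> fx Lx expL; have fx0 : f x != 0.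
  by rewrite -(nbhs_singleton expL) cexp_neq0.
apply: is_diff_eq (is_diffM fx (is_diff_log fx Lx expL)) _.
apply/funext => h; rewrite -[LHS]/(f x * ((f x)^-1 * df h) + L x * df h).
by rewrite mulVKf // mulrDl mul1r.
Qed.

End ComplexExponential.

(** * Integral linear forms and monomials of a term *)

Lemma row_mx_ord0 (T : Type) (r : nat) (c : 'rV[T]_1) (w : 'rV[T]_r) :
  row_mx c w 0 ord0 = c 0 0.
Proof.
by rewrite -(row_mxEl c w 0 0); congr (row_mx c w 0 _); exact/val_inj.
Qed.

Lemma row_mx_lift0 (T : Type) (r : nat) (c : 'rV[T]_1) (w : 'rV[T]_r)
    (i : 'I_r) :
  row_mx c w 0 (lift ord0 i) = w 0 i.
Proof.
by rewrite -(row_mxEr c w 0 i); congr (row_mx c w 0 _); exact/val_inj.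
Qed.

Section LinearForms.
Context {F : comPzRingType}.
Implicit Types n r s : nat.

Definition form_eval n (A : 'rV[int]_n) (x : 'rV[F]_n) : F :=
  \sum_i (A 0 i)%:~R * x 0 i.

Lemma form_eval_sum n (I : finType) (c : I -> int) (A : I -> 'rV[int]_n)
    (x : 'rV[F]_n) :
  form_eval (\sum_k c k *: A k) x = \sum_k (c k)%:~R * form_eval (A k) x.
Proof.
under [RHS]eq_bigr do rewrite mulr_sumr.
rewrite exchange_big; apply: eq_bigr => i _ /=.
rewrite summxE rmorph_sum mulr_suml; apply: eq_bigr => k _.
by rewrite mxE /= intrM mulrA.
Qed.

Lemma form_eval0 n (x : 'rV[F]_n) : form_eval 0 x = 0.
Proof. by apply: big1 => i _; rewrite mxE mul0r. Qed.

Lemma form_eval_mulmx n m (A : 'rV[int]_n) (phi : 'M[int]_(m, n))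
    (x : 'rV[F]_m) :
  form_eval (A *m phi^T) x = form_eval A (x *m map_mx intr phi).
Proof.
rewrite /form_eval; under eq_bigr do rewrite mxE rmorph_sum mulr_suml.
rewrite exchange_big; apply: eq_bigr => i _ /=.
rewrite mxE mulr_sumr; apply: eq_bigr => k _.
by rewrite !mxE /= intrM mulrA mulrAC -mulrA.
Qed.

Lemma form_evalZ n (A : 'rV[int]_n) (c : F) (x : 'rV[F]_n) :
  form_eval A (c *: x) = c * form_eval A x.
Proof.
by rewrite /form_eval mulr_sumr; apply: eq_bigr => i _; rewrite mxE mulrCA.
Qed.

Lemma form_evalD n (A : 'rV[int]_n) (x y : 'rV[F]_n) :
  form_eval A (x + y) = form_eval A x + form_eval A y.
Proof. by rewrite -big_split; apply: eq_bigr => i _; rewrite mxE mulrDr. Qed.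

Definition homog_dir r (w : 'rV[F]_r) : 'rV[F]_r.+1 := row_mx (0 : 'rV_1) w.

Lemma homog_ord0 r (w : 'rV[F]_r) : homog w 0 ord0 = 1.
Proof. by rewrite row_mx_ord0 mxE. Qed.

Lemma homog_lift0 r (w : 'rV[F]_r) (i : 'I_r) : homog w 0 (lift ord0 i) = w 0 i.
Proof. exact: row_mx_lift0. Qed.

Lemma homog_dir_ord0 r (w : 'rV[F]_r) : homog_dir w 0 ord0 = 0.
Proof. by rewrite row_mx_ord0 mxE. Qed.

Lemma homog_dir_lift0 r (w : 'rV[F]_r) (i : 'I_r) :
  homog_dir w 0 (lift ord0 i) = w 0 i.
Proof. exact: row_mx_lift0. Qed.

Lemma dehom_form_eval r (A : 'rV[int]_r.+1) (w : 'rV[F]_r) :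
  dehom A w = form_eval A (homog w).
Proof.
rewrite /form_eval big_ord_recl homog_ord0 mulr1; congr (_ + _).
by apply: eq_bigr => i _; rewrite homog_lift0.
Qed.

Lemma dehom_affine r (A : 'rV[int]_r.+1) (a b : F) (u v : 'rV[F]_r) :
  a + b = 1 ->
  dehom A (a *: u + b *: v) = a * dehom A u + b * dehom A v.
Proof.
move=> ab1; rewrite !dehom_form_eval -!form_evalZ -form_evalD; congr form_eval.
apply/rowP => i; rewrite [RHS]mxE ![(_ *: homog _) _ _]mxE.
have [k ->|->] := unliftP ord0 i; first by rewrite !homog_lift0 !mxE.
by rewrite !homog_ord0 !mulr1.
Qed.

Lemma dehom0 r (w : 'rV[F]_r) : dehom 0 w = 0.
Proof. by rewrite dehom_form_eval form_eval0. Qed.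

End LinearForms.

Definition term_monomial (R : realType) (r : nat) (t : hyp_term R r)
    (w : 'rV[CC R]_r) (i : 'I_r.+1) : CC R :=
  tC t i * \prod_j dehom (tA t j) w ^ (teps t j * vcoef i (tA t j)).

(* The logarithm of term_monomial t w i, or its logarithmic derivative, in terms
   of those of the C_i and of the A_j(w). *)
Definition log_monomial (R : realType) (r : nat) (t : hyp_term R r)
    (F : pzRingType) (lC : 'I_r.+1 -> F) (lA : 'I_(tJ t) -> F)
    (i : 'I_r.+1) : F :=
  lC i + \sum_j (teps t j * vcoef i (tA t j))%:~R * lA j.
Arguments log_monomial {R r} t {F} lC lA i.

Definition form_logs (R : realType) (r : nat) (t : hyp_term R r)
    (w : 'rV[CC R]_r) (lA : 'I_(tJ t) -> CC R) : Prop :=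
  forall j, dehom (tA t j) w != 0 -> cexp (lA j) = dehom (tA t j) w.
Arguments form_logs {R r} t w lA.

Section TermMonomials.
Context {R : realType} {r : nat}.
Implicit Types (t : hyp_term R r) (w : 'rV[CC R]_r).

Lemma sum_log_monomial t (F : comPzRingType) lC lA (x : 'rV[F]_r.+1) :
  \sum_i x 0 i * log_monomial t lC lA i =
  \sum_i x 0 i * lC i + \sum_j (teps t j)%:~R * form_eval (tA t j) x * lA j.
Proof.
under eq_bigr do rewrite mulrDr mulr_sumr.
rewrite big_split exchange_big /=; congr (_ + _); apply: eq_bigr => j _.
rewrite mulr_sumr mulr_suml; apply: eq_bigr => i _.
by rewrite intrM /vcoef; ring.
Qed.

Lemma potential_log_monomial t lC lA w :
  potential t lC lA w = \sum_i homog w 0 i * log_monomial t lC lA i.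
Proof.
rewrite sum_log_monomial /potential big_ord_recl homog_ord0 mul1r.
congr (_ + _ + _); apply: eq_bigr => k _; first by rewrite homog_lift0.
by rewrite dehom_form_eval.
Qed.

Lemma balanced_eps_neq0 t : balanced t -> forall j, teps t j != 0.
Proof. by case=> _ _ eps1 _ j; case: (eps1 j) => ->. Qed.

Lemma balanced_form_eval t (F : comPzRingType) (x : 'rV[F]_r.+1) :
  balanced t -> \sum_j (teps t j)%:~R * form_eval (tA t j) x = 0.
Proof. by case=> _ _ _ bal; rewrite -form_eval_sum bal form_eval0. Qed.

Lemma log_monomial_shift t (F : pzRingType) lC lA (c : F) i : balanced t ->
  log_monomial t lC (fun j => lA j + c) i = log_monomial t lC lA i.
Proof.
case=> _ _ _ bal; congr (_ + _); under eq_bigr do rewrite mulrDr.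
rewrite big_split -mulr_suml -(rmorph_sum (intmul 1)) /=.
rewrite (_ : \sum_j _ = (\sum_j teps t j *: tA t j) 0 i).
  by rewrite bal mxE mul0r addr0.
by rewrite summxE; apply: eq_bigr => j _; rewrite mxE.
Qed.

Lemma notin_arrangementP t w :
  (~` arrangement t) w <-> forall j, dehom (tA t j) w = 0 -> tA t j = 0.
Proof.
split=> [warr j Aw0|A0 [j A_neq0 /A0/eqP]]; last exact/negP.
by apply/eqP/negPn/negP => A_neq0; apply: warr; exists j.
Qed.

Lemma variational_notin_arrangement t w : balanced t ->
  variational_solutions t w -> (~` arrangement t) w.
Proof.
move=> /balanced_eps_neq0 eps0 Xw; apply/notin_arrangementP => j Aw0.
have v0 i : vcoef (lift ord0 i) (tA t j) = 0.
  apply: contra_eq (Xw i) => v_neq0; rewrite (bigD1 j) //= Aw0 exp0rz.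
  rewrite mulf_eq0 (negPf (eps0 j)) (negPf v_neq0) mul0r mulr0 eq_sym.
  exact: oner_neq0.
apply/rowP => i; rewrite mxE; have [k ->|->] := unliftP ord0 i; first exact: v0.
move: Aw0; rewrite /dehom big1 => [|k _]; last by rewrite v0 mul0r.
by rewrite addr0 => /eqP; rewrite intr_eq0 => /eqP.
Qed.

Lemma exists_form_logs t w : exists lA, form_logs t w lA.
Proof.
suff /choice[lA lAE] j : exists x : CC R,
    dehom (tA t j) w != 0 -> cexp x = dehom (tA t j) w by exists lA.
have [->|/cexp_surj[x xE]] := eqVneq (dehom (tA t j) w) 0; last by exists x.
by exists 0.
Qed.

Lemma exists_log_constants t : balanced t -> exists lC, log_constants t lC.
Proof.
case=> C_neq0 _ _ _.
suff /choice[lC lCt] i : exists x, cexp x = tC t i by exists lC.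
exact/cexp_surj/C_neq0.
Qed.

Lemma cexp_log_monomial t w lC lA i : (~` arrangement t) w ->
  log_constants t lC -> form_logs t w lA ->
  cexp (log_monomial t lC lA i) = term_monomial t w i.
Proof.
move=> /notin_arrangementP form0 lCt lAw.
rewrite cexpD lCt cexp_sum; congr (_ * _); apply: eq_bigr => j _.
rewrite cexpMz; have [/form0 ->|/lAw -> //] := eqVneq (dehom (tA t j) w) 0.
by rewrite /vcoef mxE mulr0 !expr0z.
Qed.

Lemma term_monomial_neq0 t w i : balanced t -> (~` arrangement t) w ->
  term_monomial t w i != 0.
Proof.
move=> bal w_notin; have [lC lCt] := exists_log_constants bal.
have [lA lAw] := exists_form_logs t w.
by rewrite -(cexp_log_monomial i w_notin lCt lAw) cexp_neq0.
Qed.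

Lemma term_monomialV t w i : (term_monomial t w i)^-1 =
  (tC t i)^-1 * \prod_j dehom (tA t j) w ^ (- (teps t j * vcoef i (tA t j))).
Proof.
rewrite invfM -prodfV; congr (_ * _).
by apply: eq_bigr => j _; rewrite invr_expz.
Qed.

Lemma prod_dehom_neq0 t w (m : 'I_(tJ t) -> int) :
  (forall j, dehom (tA t j) w = 0 -> m j = 0) ->
  \prod_(j | dehom (tA t j) w != 0) dehom (tA t j) w ^ m j =
  \prod_j dehom (tA t j) w ^ m j.
Proof.
move=> m0; rewrite big_mkcond; apply: eq_bigr => j _.
by case: eqP => //= /m0 ->; rewrite expr0z.
Qed.

Lemma critical_valueE t w : (~` arrangement t) w ->
  (tC t ord0)^-1 * \prod_(j | dehom (tA t j) w != 0)
    dehom (tA t j) w ^ (- (teps t j * vcoef ord0 (tA t j))) =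
  (term_monomial t w ord0)^-1.
Proof.
move=> /notin_arrangementP form0.
rewrite prod_dehom_neq0 ?term_monomialV // => j /form0 ->.
by rewrite /vcoef mxE mulr0 oppr0.
Qed.

Lemma CV_term_monomial t : balanced t ->
  CV t = [set (term_monomial t w ord0)^-1 | w in variational_solutions t].
Proof.
move=> bal; rewrite /CV; apply: eq_imagel => w Xw.
exact/critical_valueE/variational_notin_arrangement.
Qed.

End TermMonomials.

(** * Critical points of the potential *)

Section CriticalPoints.
Context {R : realType} {r : nat}.
Implicit Types (w x h : 'rV[CC R]_r).

Lemma is_diff_homog x (i : 'I_r.+1) :
  is_diff x (fun w => homog w 0 i : CC R) (fun h => homog_dir h 0 i : CC R).
Proof.
have [k ->|->] := unliftP ord0 i.
  under eq_fun do rewrite homog_lift0.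
  under [X in is_diff _ _ X]eq_fun do rewrite homog_dir_lift0.
  exact: is_diff_coord.
under eq_fun do rewrite homog_ord0.
under [X in is_diff _ _ X]eq_fun do rewrite homog_dir_ord0.
exact: is_diff_cst.
Qed.

Lemma is_diff_sum_homog (c : 'I_r.+1 -> CC R) x :
  is_diff x (fun w => \sum_i c i * homog w 0 i : CC R)
    (fun h => \sum_i c i * homog_dir h 0 i : CC R).
Proof.
apply: (is_diff_sum (f := fun i w => c i * homog w 0 i : CC R)) => i.
exact: (@is_diffZ _ _ _ _ _ (c i) x (is_diff_homog x i)).
Qed.

Lemma is_diff_dehom (A : 'rV[int]_r.+1) x :
  is_diff x (fun w => dehom A w : CC R)
    (fun h => form_eval A (homog_dir h) : CC R).
Proof.
under eq_fun do rewrite dehom_form_eval.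
exact: is_diff_sum_homog.
Qed.

Variable t : hyp_term R r.
Hypothesis t_balanced : balanced t.
Variables (E : topologicalType) (p : E -> 'rV[CC R]_r).
Hypothesis p_cover : covering_map (~` arrangement t) p.
Variable lA : 'I_(tJ t) -> E -> CC R.
Hypothesis lA_branches : log_branches t p lA.
Implicit Types (lC : 'I_r.+1 -> CC R) (e : E).

Lemma covering_notin_arrangement e : (~` arrangement t) (p e).
Proof. by case: p_cover => _ <- _; exists e. Qed.

Lemma log_branches_form_logs e : form_logs t (p e) (lA^~ e).
Proof. by move=> j; have [_] := lA_branches j; apply. Qed.

Lemma is_diff_dehom_log e s j :
  s (p e) = e -> {for p e, continuous s} ->
  (\forall w \near p e, p (s w) = w) ->
  is_diff (p e) (fun w => dehom (tA t j) w * lA j (s w) : CC R)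
    (fun h => (1 + lA j e) * form_eval (tA t j) (homog_dir h)).
Proof.
move=> se s_cont ps.
have [Aj0|Aj_neq0] := eqVneq (tA t j) 0.
  rewrite Aj0; under eq_fun do rewrite dehom0 mul0r.
  under [X in is_diff _ _ X]eq_fun do rewrite form_eval0 mulr0.
  exact: is_diff_cst.
have A_neq0 : dehom (tA t j) (p e) != 0.
  have /notin_arrangementP := @covering_notin_arrangement e.
  by move=> /(_ j)/contra_neq; exact.
have A_diff := is_diff_dehom (tA t j) (p e).
have A_cont : {for p e, continuous (fun w => dehom (tA t j) w : CC R)}.
  exact: differentiable_continuous (@ex_diff _ _ _ _ _ _ _ A_diff).
have A_near : \forall w \near p e, dehom (tA t j) w != 0.
  exact: cvgr_neq0 A_cont A_neq0.
have log_cont : {for p e, continuous (lA j \o s)}.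
  by apply: continuous_comp; [exact: s_cont | exact: (lA_branches j).1].
rewrite -[in lA j e]se; apply: (is_diff_xlogx A_diff log_cont).
apply: filterS2 ps A_near => w psw Aw_neq0 /=.
by rewrite log_branches_form_logs psw.
Qed.

Lemma is_diff_lifted_potential lC e s :
  s (p e) = e -> {for p e, continuous s} ->
  (\forall w \near p e, p (s w) = w) ->
  is_diff (p e) (lifted_potential t p lC lA \o s)
    (fun h => \sum_i h 0 i * log_monomial t lC (lA^~ e) (lift ord0 i)).
Proof.
move=> se s_cont ps.
have eps_diff j := @is_diffZ _ _ _ _ _ ((teps t j)%:~R : CC R) (p e)
  (is_diff_dehom_log j se s_cont ps).
have V_diff := is_diffD (is_diff_sum_homog lC (p e)) (is_diff_sum eps_diff).
apply: near_eq_is_diff (is_diff_eq V_diff _).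
  apply: filterS ps => w psw; rewrite /= /lifted_potential psw.
  rewrite potential_log_monomial sum_log_monomial.
  congr (_ + _); apply: eq_bigr => k _; first exact: mulrC.
  by rewrite -dehom_form_eval -mulrA.
apply/funext => h; pose x := homog_dir h.
transitivity (\sum_i x 0 i * log_monomial t lC (lA^~ e) i); last first.
  rewrite big_ord_recl homog_dir_ord0 mul0r add0r.
  by apply: eq_bigr => i _; rewrite homog_dir_lift0.
rewrite sum_log_monomial; congr (_ + _).
  by apply: eq_bigr => i _; exact: mulrC.
rewrite -[RHS]add0r -[X in X + _](balanced_form_eval x t_balanced).
rewrite -big_split; apply: eq_bigr => j _ /=.
by rewrite -[LHS]/((teps t j)%:~R * ((1 + lA j e) * form_eval (tA t j) x));
  ring.
Qed.

Lemma critical_pointP lC e :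
  critical_point p (lifted_potential t p lC lA) e <->
  forall i : 'I_r, log_monomial t lC (lA^~ e) (lift ord0 i) = 0.
Proof.
split=> [[s [se s_cont ps V_diff]] i|gradient0].
  have := is_diff_unique (is_diff_lifted_potential lC se s_cont ps) V_diff.
  move=> /(congr1 (@^~ (delta_mx 0 i))) /=.
  rewrite (bigD1 i) //= mxE !eqxx mul1r big1 ?addr0 // => k ki.
  by rewrite mxE eqxx (negPf ki) mul0r.
case: p_cover => _ _ /(_ _ (@covering_notin_arrangement e)).
move=> [U [I [s [U_open Ue _ [s_cont ps _ sheets]]]]].
have [i [se _]] := sheets e Ue.
have ps_near : \forall w \near p e, p (s i w) = w.
  by apply: filterS (open_nbhs_nbhs (conj U_open Ue)) => w; exact: ps.
exists (s i); split; [exact: se | exact: s_cont | exact: ps_near |].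
apply: is_diff_eq (is_diff_lifted_potential lC se (s_cont _ _ Ue) ps_near) _.
by apply/funext => h; rewrite big1 // => k _; rewrite gradient0 mulr0.
Qed.

Lemma cexp_log_monomial_branches lC e i : log_constants t lC ->
  cexp (log_monomial t lC (lA^~ e) i) = term_monomial t (p e) i.
Proof.
move=> lCt.
exact: cexp_log_monomial (@covering_notin_arrangement e) lCt
  (@log_branches_form_logs e).
Qed.

Lemma variational_critical :
  p @^-1` variational_solutions t =
    [set e | exists2 lC, log_constants t lC &
               critical_point p (lifted_potential t p lC lA) e].
Proof.
apply/seteqP; split=> e /=; last first.
  move=> [lC lCt /critical_pointP gradient0] i.
  rewrite -[LHS](cexp_log_monomial_branches e (lift ord0 i) lCt).
  by rewrite gradient0 cexp0.
move=> Xe; have [l l_logs] := exists_log_constants t_balanced.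
pose lC k := if k == ord0 then l k else l k - log_monomial t l (lA^~ e) k.
exists lC; last first.
  by apply/critical_pointP => i; rewrite /log_monomial /lC opprD addNKr addNr.
move=> k; rewrite /lC; have [i ->|->] := unliftP ord0 k; last by rewrite eqxx.
rewrite cexpD cexpN l_logs cexp_log_monomial_branches //.
by rewrite (Xe i : term_monomial _ _ _ = 1) invr1 mulr1.
Qed.

Lemma cexp_critical_value lC e : log_constants t lC ->
  critical_point p (lifted_potential t p lC lA) e ->
  cexp (- lifted_potential t p lC lA e) = (term_monomial t (p e) ord0)^-1.
Proof.
move=> lCt /critical_pointP gradient0.
rewrite cexpN /lifted_potential potential_log_monomial big_ord_recl homog_ord0.
rewrite mul1r big1 ?addr0 ?cexp_log_monomial_branches // => i _.
by rewrite gradient0 mulr0.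
Qed.

Lemma CV_critical_values :
  CV t = [set z | exists lC e,
    [/\ log_constants t lC, critical_point p (lifted_potential t p lC lA) e &
        z = cexp (- lifted_potential t p lC lA e)]].
Proof.
rewrite CV_term_monomial //; apply/seteqP; split=> z /=.
  move=> [w Xw <-]; have := variational_notin_arrangement t_balanced Xw.
  case: (p_cover) => _ <- _ [e _ pe]; rewrite -pe in Xw *.
  have : (p @^-1` variational_solutions t) e by [].
  rewrite variational_critical => -[lC lCt e_crit].
  by exists lC, e; rewrite cexp_critical_value.
move=> [lC [e [lCt e_crit ->]]].
exists (p e); last by rewrite cexp_critical_value.
suff : (p @^-1` variational_solutions t) e by [].
by rewrite variational_critical; exists lC.
Qed.

End CriticalPoints.

(** * Restriction to a face *)

Section Restriction.
Context {r s : nat} (phi : 'M[int]_(s.+1, r.+1)).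
Hypothesis phi_l0 : forall l : 'I_s, phi (lift ord0 l) ord0 = 0.

Lemma homog_affine_param (F : fieldType) (w : 'rV[F]_s) :
  (phi ord0 ord0)%:~R != 0 :> F ->
  homog w *m map_mx intr phi =
  (phi ord0 ord0)%:~R *: homog (affine_param phi w).
Proof.
move=> d0; apply/rowP => i.
rewrite [LHS]mxE [RHS]mxE big_ord_recl homog_ord0 mul1r.
have [k ->|->] := unliftP ord0 i; last first.
  rewrite [X in X + _]mxE homog_ord0 mulr1 big1 ?addr0 // => l _.
  by rewrite [X in _ * X]mxE phi_l0 mulr0.
rewrite homog_lift0 [affine_param _ _ _ _]mxE [RHS]mulrC divfK // /dehom /vcoef.
congr (_ + _); first by rewrite !mxE.
by apply: eq_bigr => l _; rewrite homog_lift0 mulrC !mxE.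
Qed.

Lemma dehom_restrict (F : fieldType) (A : 'rV[int]_r.+1) (w : 'rV[F]_s) :
  (phi ord0 ord0)%:~R != 0 :> F ->
  dehom (A *m phi^T) w = (phi ord0 ord0)%:~R * dehom A (affine_param phi w).
Proof.
move=> d0.
by rewrite !dehom_form_eval form_eval_mulmx homog_affine_param // form_evalZ.
Qed.

Context {R : realType} {t : hyp_term R r}.
Hypothesis t_balanced : balanced t.
Hypothesis phi00_gt0 : 0 < phi ord0 ord0.
Implicit Types (w : 'rV[CC R]_s).
Implicit Types (lC : 'I_r.+1 -> CC R) (lA : 'I_(tJ t) -> CC R).

Local Notation d := ((phi ord0 ord0)%:~R : CC R).

Let d_neq0 : d != 0. Proof. by rewrite intr_eq0 gt_eqF. Qed.

Lemma log_monomial_restrict lC lA l :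
  log_monomial (restrict_term t phi) (restrict_logs phi lC) lA l =
  \sum_i (phi l i)%:~R * log_monomial t lC lA i.
Proof.
pose x : 'rV[CC R]_r.+1 := map_mx intr (row l phi).
have xE i : x 0 i = (phi l i)%:~R by rewrite !mxE.
under [RHS]eq_bigr do rewrite -xE.
rewrite sum_log_monomial; congr (_ + _).
  by apply: eq_bigr => i _; rewrite xE.
apply: eq_bigr => j _; rewrite intrM /vcoef mxE rmorph_sum /=;
  congr (_ * _ * _).
by apply: eq_bigr => i _; rewrite xE !mxE intrM.
Qed.

Lemma restrict_log_constants lC : log_constants t lC ->
  log_constants (restrict_term t phi) (restrict_logs phi lC).
Proof.
move=> lCt l; rewrite /restrict_logs cexp_sum /=.
by apply: eq_bigr => i _; rewrite cexpMz lCt.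
Qed.

Lemma potential_restrict lC lA c w :
  potential (restrict_term t phi) (restrict_logs phi lC) (fun j => lA j + c) w =
  d * potential t lC lA (affine_param phi w).
Proof.
have restrict_balanced := balanced_restrict phi t_balanced.
rewrite !potential_log_monomial mulr_sumr.
under eq_bigr do rewrite (log_monomial_shift _ _ _ _ restrict_balanced)
  log_monomial_restrict mulr_sumr.
rewrite exchange_big; apply: eq_bigr => i _ /=.
have := congr1 (fun v : 'rV_r.+1 => v 0 i) (homog_affine_param w d_neq0).
rewrite [LHS]mxE [RHS]mxE mulrA => <-; rewrite mulr_suml; apply: eq_bigr => l _.
by rewrite [map_mx _ _ _ _]mxE mulrA.
Qed.

Lemma notin_arrangement_restrict w : (~` arrangement t) (affine_param phi w) ->
  (~` arrangement (restrict_term t phi)) w.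
Proof.
move=> /notin_arrangementP form0; apply/notin_arrangementP => j /eqP.
rewrite dehom_restrict // mulf_eq0 (negPf d_neq0) => /eqP/form0 /= ->.
by rewrite mul0mx.
Qed.

(* The factor d in A_j|_phi = d * A_j cancels because t is balanced. *)
Lemma term_monomial_restrict w l : (~` arrangement t) (affine_param phi w) ->
  term_monomial (restrict_term t phi) w l =
  \prod_i term_monomial t (affine_param phi w) i ^ phi l i.
Proof.
move=> w_notin.
have [lC lCt] := exists_log_constants t_balanced.
have [lA lAw] := exists_form_logs t (affine_param phi w).
have [c cE] := cexp_surj d_neq0.
under eq_bigr do rewrite -(cexp_log_monomial _ w_notin lCt lAw) -cexpMz.
have restrict_balanced := balanced_restrict phi t_balanced.
rewrite -cexp_sum -log_monomial_restrict -(log_monomial_shift _ _ c) //.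
rewrite (@cexp_log_monomial _ _ _ w) //.
- exact: notin_arrangement_restrict.
- exact: restrict_log_constants.
- move=> j; rewrite dehom_restrict // mulf_eq0 (negPf d_neq0) /= => /lAw aE.
  by rewrite cexpD aE cE mulrC.
Qed.

Lemma potential_branches_restrict (E : topologicalType)
    (p : E -> 'rV[CC R]_s) lC :
  potential_branches (restrict_term t phi) p (restrict_logs phi lC) =
  [set (fun e => d * V e)
    | V in potential_branches t (affine_param phi \o p) lC].
Proof.
have [c cE] := cexp_surj d_neq0.
have aE j e : dehom (tA t j *m phi^T) (p e) =
    d * dehom (tA t j) (affine_param phi (p e)) by exact: dehom_restrict.
apply/seteqP; split=> V /=.
  move=> [lA lA_branches <-]; pose lA' j e := lA j e - c.
  exists (lifted_potential t (affine_param phi \o p) lC lA').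
    exists lA' => // j; have [lA_cont lAE] := lA_branches j; split.
      by move=> e; apply: cvgB; [exact: lA_cont | exact: cvg_cst].
    move=> e /= A_neq0; rewrite cexpD cexpN cE lAE aE ?mulf_neq0 //.
    by rewrite mulrC mulKf.
  apply/funext => e; rewrite /lifted_potential -(potential_restrict _ _ c) /=.
  by congr potential; apply/funext => j; rewrite subrK.
move=> [_ [lA lA_branches <-] <-]; exists (fun j e => lA j e + c); last first.
  by apply/funext => e; rewrite /lifted_potential potential_restrict.
move=> j; have [lA_cont lAE] := lA_branches j; split.
  by move=> e; apply: cvgD; [exact: lA_cont | exact: cvg_cst].
move=> e /=; rewrite aE mulf_eq0 negb_or => /andP[_ A_neq0].
by rewrite cexpD lAE // cE mulrC.
Qed.

End Restriction.

(** * Derivations of a field of characteristic zero *)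

Lemma size_cancel_lead_coef (R : comNzRingType) (p q : {poly R}) :
  p != 0 -> q != 0 -> (size q <= size p)%N ->
  (size (lead_coef q *: p - lead_coef p *: ('X^(size p - size q) * q))%R <
   size p)%N.
Proof.
move=> p_neq0 q_neq0 size_qp.
have [size_q size_p] : (0 < size q)%N /\ (0 < size p)%N.
  by rewrite !size_poly_gt0.
apply: (@leq_ltn_trans (size p).-1); last by rewrite prednK.
apply/leq_sizeP => j j_ge.
rewrite coefB !coefZ coefXnM ifN -?leqNgt; last by lia.
have [j_eq|j_neq] := eqVneq j (size p).-1; last first.
  have [p_j q_j] : (size p <= j)%N /\ (size q <= j - (size p - size q))%N.
    by lia.
  by rewrite (nth_default _ p_j) (nth_default _ q_j) !mulr0 subrr.
have -> : (j - (size p - size q))%N = (size q).-1 by lia.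
by rewrite j_eq -!lead_coefE mulrC subrr.
Qed.

Lemma deriv_neq0 (F : fieldType) (p : {poly F}) :
  [pchar F] =i pred0 -> (1 < size p)%N -> p^`() != 0.
Proof.
move=> /pcharf0P pchar0 size_p; apply/negP => /eqP/polyP/(_ (size p).-2).
rewrite coef_deriv coef0 -mulr_natr => /eqP; rewrite mulf_eq0 pchar0 orbF.
have -> : (size p).-2.+1 = (size p).-1 by lia.
by rewrite -lead_coefE lead_coef_eq0 -size_poly_eq0; move: size_p; case: size.
Qed.

Section DerivationGraphs.

Definition dual_mul (S : pzRingType) (a b : S * S) : S * S :=
  (a.1 * b.1, a.2 * b.1 + a.1 * b.2).

Context {L : fieldType}.
Implicit Types (G : set (L * L)) (u v : {poly L} * {poly L}).
Implicit Types (a b : L * L) (x : L).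

(* The graph of a derivation defined on a subring of L: a subring of the dual
   numbers L[e] that meets e L trivially, with (x, x') standing for x + e x'. *)
Definition derivation_graph G : Prop :=
  [/\ G (1, 0), forall a b, G a -> G b -> G (a - b),
      forall a b, G a -> G b -> G (dual_mul a b) &
      forall x', G (0, x') -> x' = 0].

Definition dual_horner x (x' : L) u : L * L :=
  (u.1.[x], u.2.[x] + u.1^`().[x] * x').

Lemma dual_hornerB x x' u v :
  dual_horner x x' (u - v) = dual_horner x x' u - dual_horner x x' v.
Proof.
by rewrite /dual_horner /= derivB !hornerD !hornerN; congr pair => /=; ring.
Qed.

Lemma dual_hornerM x x' u v :
  dual_horner x x' (dual_mul u v) =
  dual_mul (dual_horner x x' u) (dual_horner x x' v).
Proof.
by rewrite /dual_horner /dual_mul /= derivM !hornerE; congr pair; ring.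
Qed.

Lemma dual_hornerC x x' a : dual_horner x x' (a.1%:P, a.2%:P) = a.
Proof.
by rewrite /dual_horner !hornerC derivC horner0 mul0r addr0 -surjective_pairing.
Qed.

Definition dual_polyOver G u : Prop := forall i, G (u.1`_i, u.2`_i).

Definition adjoin_graph G x x' : set (L * L) :=
  dual_horner x x' @` dual_polyOver G.

Section GraphTheory.
Variable G : set (L * L).
Hypothesis G_graph : derivation_graph G.

Lemma derivation_graph0 : G 0.
Proof.
by case: G_graph => G1 GB _ _; rewrite -(subrr (1, 0)); exact: GB.
Qed.

Lemma derivation_graphD a b : G a -> G b -> G (a + b).
Proof.
case: G_graph => _ GB _ _ Ga Gb; rewrite -[b]opprK -[- b]sub0r.
exact: (GB _ _ Ga (GB _ _ derivation_graph0 Gb)).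
Qed.

Lemma derivation_graphMn a n : G a -> G (a.1 *+ n, a.2 *+ n).
Proof.
move=> Ga; elim: n => [|n IHn]; first exact: derivation_graph0.
by rewrite !mulrS; exact: derivation_graphD Ga IHn.
Qed.

Lemma dual_polyOverC a : G a -> dual_polyOver G (a.1%:P, a.2%:P).
Proof.
by case: a => x x' Ga i; rewrite !coefC; case: eqP => _ //;
  exact: derivation_graph0.
Qed.

Lemma dual_polyOverXn n : dual_polyOver G ('X^n, 0).
Proof.
move=> i; rewrite coefXn coef0.
by case: eqP => _; [case: G_graph | exact: derivation_graph0].
Qed.

Lemma dual_polyOverB u v :
  dual_polyOver G u -> dual_polyOver G v -> dual_polyOver G (u - v).
Proof.
by case: G_graph => _ GB _ _ Gu Gv i; rewrite /= !coefB;
  exact: GB (Gu i) (Gv i).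
Qed.

Lemma dual_polyOverM u v :
  dual_polyOver G u -> dual_polyOver G v -> dual_polyOver G (dual_mul u v).
Proof.
case: G_graph => _ _ GM _ Gu Gv i; rewrite coefD !coefM -big_split.
apply: (big_ind2 (fun x x' => G (x, x'))) => [|x y x' y'|k _].
- exact: derivation_graph0.
- exact: derivation_graphD.
- exact: GM (Gu k) (Gv (i - k)%N).
Qed.

Lemma dual_polyOver_deriv u :
  dual_polyOver G u -> dual_polyOver G (u.1^`(), u.2^`()).
Proof.
by move=> Gu i; rewrite !coef_deriv; exact: derivation_graphMn (Gu i.+1).
Qed.

Lemma dual_polyOver_eq0 u : dual_polyOver G u -> u.1 = 0 -> u.2 = 0.
Proof.
move=> Gu u0; apply/polyP => i; have := Gu i; rewrite u0 !coef0.
by case: G_graph => _ _ _; apply.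
Qed.

Lemma adjoin_graph_sub x x' : G `<=` adjoin_graph G x x'.
Proof.
move=> a Ga; exists (a.1%:P, a.2%:P); last exact: dual_hornerC.
exact: dual_polyOverC.
Qed.

Lemma adjoin_graph_gen x x' : adjoin_graph G x x' (x, x').
Proof.
exists ('X^1, 0); first exact: dual_polyOverXn.
by rewrite /dual_horner hornerX horner0 derivX hornerC mul1r add0r.
Qed.

Lemma adjoin_derivation_graph x x' :
  (forall u, dual_polyOver G u -> root u.1 x -> (dual_horner x x' u).2 = 0) ->
  derivation_graph (adjoin_graph G x x').
Proof.
move=> root_x.
split=> [|_ _ [u Gu <-] [v Gv <-]|_ _ [u Gu <-] [v Gv <-]|y' [u Gu]].
- by apply: adjoin_graph_sub; case: G_graph.
- by exists (u - v); [exact: dual_polyOverB | exact: dual_hornerB].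
- by exists (dual_mul u v); [exact: dual_polyOverM | exact: dual_hornerM].
- by case=> /rootP ux <-; exact: root_x.
Qed.

Definition minimal_annihilator x u : Prop :=
  [/\ dual_polyOver G u, u.1 != 0, root u.1 x &
    forall v, dual_polyOver G v -> v.1 != 0 -> root v.1 x ->
      (size u.1 <= size v.1)%N].

Lemma minimal_annihilator_deriv_neq0 x m : [pchar L] =i pred0 ->
  minimal_annihilator x m -> m.1^`().[x] != 0.
Proof.
move=> pchar0 [Gm m_neq0 mx m_min]; apply/negP => dmx.
have size_m : (1 < size m.1)%N by exact: root_size_gt1 mx.
have := m_min _ (dual_polyOver_deriv Gm) (deriv_neq0 pchar0 size_m) dmx.
by rewrite leqNgt lt_size_deriv.
Qed.

(* Cancelling leading terms against m makes any u vanishing at x smaller. *)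
Lemma minimal_annihilator_dual_horner0 x x' m : minimal_annihilator x m ->
  dual_horner x x' m = 0 ->
  forall u, dual_polyOver G u -> root u.1 x -> (dual_horner x x' u).2 = 0.
Proof.
move=> [Gm m_neq0 _ m_min] mx u.
move: {2}(size u.1) (leqnn (size u.1)) => n.
elim: n u => [|n IHn] u size_u Gu ux.
  move: size_u; rewrite leqn0 size_poly_eq0 => /eqP u0.
  by rewrite /= (dual_polyOver_eq0 Gu u0) u0 deriv0 !horner0 mul0r addr0.
have [u0|u_neq0] := eqVneq u.1 0.
  by apply: IHn => //; rewrite u0 size_poly0.
pose lead v : L * L := (v.1`_(size v.1).-1, v.2`_(size v.1).-1).
pose v := dual_mul ((lead m).1%:P, (lead m).2%:P) u -
  dual_mul (dual_mul ((lead u).1%:P, (lead u).2%:P)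
                     ('X^(size u.1 - size m.1), 0)) m.
have Gv : dual_polyOver G v.
  apply: dual_polyOverB; apply: dual_polyOverM => //.
    exact/dual_polyOverC/Gm.
  by apply: dual_polyOverM; [exact/dual_polyOverC/Gu | exact: dual_polyOverXn].
have /= vE : dual_horner x x' v = dual_mul (lead m) (dual_horner x x' u).
  rewrite dual_hornerB !dual_hornerM mx !dual_hornerC /dual_mul /=.
  by rewrite !mulr0 addr0 subr0.
have size_v : (size v.1 < size u.1)%N.
  have := size_cancel_lead_coef u_neq0 m_neq0 (m_min _ Gu u_neq0 ux).
  by rewrite -!mul_polyC mulrA.
have vx : root v.1 x.
  by apply/rootP; rewrite -[LHS]/(dual_horner x x' v).1 vE /= (rootP ux) mulr0.
have := IHn v (leq_trans size_v size_u) Gv vx.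
rewrite vE /= (rootP ux) mulr0 add0r => /eqP.
by rewrite mulf_eq0 -lead_coefE lead_coef_eq0 (negPf m_neq0) => /eqP.
Qed.

Lemma exists_minimal_annihilator x u : dual_polyOver G u -> u.1 != 0 ->
  root u.1 x -> exists m, minimal_annihilator x m.
Proof.
move=> Gu u_neq0 ux; pose annihilator_size n :=
  `[< exists v, [/\ dual_polyOver G v, v.1 != 0, root v.1 x & size v.1 = n] >].
have exists_size : exists n, annihilator_size n.
  by exists (size u.1); apply/asboolP; exists u.
case: (ex_minnP exists_size) => n /asboolP[m [Gm m_neq0 mx <-]] m_min.
exists m; split=> // v Gv v_neq0 vx.
by apply: m_min; apply/asboolP; exists v.
Qed.

(* The derivative x' is free when x is a root of no nonzero polynomial over the
   domain; otherwise a minimal such m forces m'(x) x' = - m^D(x). *)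
Lemma extend_derivation_graph x : [pchar L] =i pred0 ->
  exists x', derivation_graph (adjoin_graph G x x').
Proof.
move=> pchar0.
have [[m m_min]|no_min] := pselect (exists m, minimal_annihilator x m).
  have dm_neq0 := minimal_annihilator_deriv_neq0 pchar0 m_min.
  exists (- m.2.[x] / m.1^`().[x]); apply: adjoin_derivation_graph.
  apply: minimal_annihilator_dual_horner0 (m_min) _.
  case: m_min => _ _ mx _.
  by rewrite /dual_horner mulrC divfK // (rootP mx) subrr.
exists 0; apply: adjoin_derivation_graph => u Gu ux.
have [u0|u_neq0] := eqVneq u.1 0.
  by rewrite /= (dual_polyOver_eq0 Gu u0) horner0 mulr0 addr0.
by case: no_min; exact: exists_minimal_annihilator Gu u_neq0 ux.
Qed.

End GraphTheory.
End DerivationGraphs.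

Definition is_derivation (L : fieldType) (D : {additive L -> L}) : Prop :=
  forall x y, D (x * y) = D x * y + x * D y.

Section DerivationExistence.
Context {L : fieldType}.
Hypothesis pchar0 : [pchar L] =i pred0.
Implicit Types (G X : set (L * L)) (x y : L).

Lemma bigcup_derivation_graph (F : set (set (L * L))) : F !=set0 ->
  (forall X, F X -> derivation_graph X) -> total_on F subset ->
  derivation_graph (\bigcup_(X in F) X).
Proof.
move=> [X0 FX0] F_graph F_total.
have common a b X Y : F X -> F Y -> X a -> Y b -> exists Z, [/\ F Z, Z a & Z b].
  move=> FX FY Xa Yb; have [XY|YX] := F_total _ _ FX FY.
    by exists Y; split=> //; exact: XY.
  by exists X; split=> //; exact: YX.
split=> [|a b [X FX Xa] [Y FY Yb]|a b [X FX Xa] [Y FY Yb]|x' [X FX]].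
- by exists X0; [|case: (F_graph _ FX0)].
- have [Z [FZ Za Zb]] := common _ _ _ _ FX FY Xa Yb.
  by exists Z => //; case: (F_graph _ FZ) => _ + _ _; apply.
- have [Z [FZ Za Zb]] := common _ _ _ _ FX FY Xa Yb.
  by exists Z => //; case: (F_graph _ FZ) => _ _ + _; apply.
- by case: (F_graph _ FX) => _ _ _; apply.
Qed.

Lemma derivation_graph_functional G x y y' :
  derivation_graph G -> G (x, y) -> G (x, y') -> y = y'.
Proof.
case=> _ GB _ G0 Gxy Gxy'; apply/eqP; rewrite -subr_eq0; apply/eqP/G0.
by rewrite -(subrr x); exact: GB Gxy Gxy'.
Qed.

Lemma total_derivation_graph G : derivation_graph G ->
  exists M, [/\ derivation_graph M, G `<=` M & forall x, exists x', M (x, x')].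
Proof.
move=> G_graph; pose extends_G X := derivation_graph (G `|` X).
have [chain chain_ext chain_total|X [GX_graph X_max]] :=
    @Zorn_bigcup _ extends_G.
  pose G_chain := [set G `|` X | X in set0 |` chain].
  have -> : extends_G (\bigcup_(X in chain) X) =
      derivation_graph (\bigcup_(X in G_chain) X).
    rewrite bigcup_image bigcupUr ?bigcup_setU1 ?set0U //.
    by exists set0; left.
  apply: bigcup_derivation_graph.
  - by exists (G `|` set0), set0; [left|].
  - by move=> _ [X [->|/chain_ext GX_graph] <-] //; rewrite setU0.
  - move=> _ _ [X X_in <-] [Y Y_in <-].
    suff : X `<=` Y \/ Y `<=` X by case=> ?; [left|right]; exact: setUS.
    case: X_in Y_in => [->|X_in] [->|Y_in];
      [left=> ?|left=> ?|right=> ?|] => //.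
    exact: chain_total.
exists (G `|` X); split=> // x.
have [x' N_graph] := extend_derivation_graph GX_graph x pchar0.
have GX_N := adjoin_graph_sub GX_graph x x'.
exists x'; right; apply: contrapT => nXx.
apply: (X_max (adjoin_graph (G `|` X) x x')).
  split; first by move=> a Xa; apply: GX_N; right.
  by move=> /(_ _ (adjoin_graph_gen GX_graph x x')).
by rewrite /extends_G setUC setUidl //; move=> a Ga; apply: GX_N; left.
Qed.

Lemma exists_derivation_extending G : derivation_graph G ->
  exists2 D : {additive L -> L}, is_derivation D & forall a, G a -> D a.1 = a.2.
Proof.
move=> /total_derivation_graph[M [M_graph GM /choice[D MD]]].
have [_ MB MM _] := M_graph.
have D_unique x y : M (x, y) -> D x = y.
  exact: derivation_graph_functional M_graph (MD x).
have D_zmod_morphism : zmod_morphism D.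
  by move=> x y; apply: D_unique; exact: MB (MD x) (MD y).
pose D_additive : {additive L -> L} :=
  HB.pack D (GRing.isZmodMorphism.Build _ _ D D_zmod_morphism).
exists D_additive => [x y|[x y] /GM]; last exact: D_unique.
by apply: D_unique; exact: MM (MD x) (MD y).
Qed.

Lemma exists_derivation_transcendental (F : fieldType)
    (iota : {rmorphism F -> L}) (z : L) : ~ algebraicOver iota z ->
  exists D : {additive L -> L}, [/\ is_derivation D, D z = 1 &
    forall c, algebraicOver iota c -> D c = 0].
Proof.
move=> z_transc.
pose G : set (L * L) := [set a | algebraicOver iota a.1 /\ a.2 = 0].
have G_graph : derivation_graph G.
  split=> [|[a a'] [b b'] [/= a_alg ->] [/= b_alg ->]|
      [a a'] [b b'] [/= a_alg ->] [/= b_alg ->]|x' []] //.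
  - by split; [exact: algebraic1|].
  - by split; [exact: algebraic_sub|rewrite /= subrr].
  - by split; [exact: algebraic_mul|rewrite /= mul0r mulr0 addr0].
have Gz_graph : derivation_graph (adjoin_graph G z 1).
  apply: adjoin_derivation_graph => // u Gu uz.
  have [u0|u_neq0] := eqVneq u.1 0.
    rewrite /= (dual_polyOver_eq0 G_graph Gu u0) u0 deriv0 !horner0.
    by rewrite mul0r addr0.
  case: z_transc; apply/integral_algebraic/(integral_root u_neq0 uz).
  by move=> _ /(nthP 0)[i _ <-]; apply/integral_algebraic; case: (Gu i).
have [D D_derivation DE] := exists_derivation_extending Gz_graph.
exists D; split=> // [|c c_alg].
  exact: DE (z, 1) (adjoin_graph_gen G_graph z 1).
by apply: (DE (c, 0)); apply: adjoin_graph_sub.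
Qed.

End DerivationExistence.

Section LogarithmicDerivative.
Context {L : fieldType} {D : {additive L -> L}}.
Hypothesis D_derivation : is_derivation D.
Implicit Types x y : L.

Definition dlog x : L := D x / x.

Lemma derivation1 : D 1 = 0.
Proof.
apply: (addrI (D 1)).
by rewrite addr0 -[in RHS](mulr1 1) D_derivation mulr1 mul1r.
Qed.

Lemma dlog1 : dlog 1 = 0.
Proof. by rewrite /dlog derivation1 mul0r. Qed.

Lemma dlogK x : x * dlog x = D x.
Proof.
have [->|x_neq0] := eqVneq x 0; first by rewrite raddf0 mul0r.
by rewrite mulrC divfK.
Qed.

Lemma dlogM x y : x != 0 -> y != 0 -> dlog (x * y) = dlog x + dlog y.
Proof.
move=> x_neq0 y_neq0; rewrite /dlog D_derivation; field.
by rewrite x_neq0 y_neq0.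
Qed.

Lemma dlogV x : dlog x^-1 = - dlog x.
Proof.
have [->|x_neq0] := eqVneq x 0; first by rewrite invr0 /dlog raddf0 mul0r oppr0.
apply/eqP; rewrite -addr_eq0 -dlogM ?invr_eq0 //.
by rewrite mulVf // dlog1.
Qed.

Lemma dlog_prod (I : finType) (f : I -> L) : (forall i, f i != 0) ->
  dlog (\prod_i f i) = \sum_i dlog (f i).
Proof.
move=> f_neq0.
suff [] : \prod_i f i != 0 /\ dlog (\prod_i f i) = \sum_i dlog (f i) by [].
elim/big_ind2: _ => [|x x' y y' [x_neq0 <-] [y_neq0 <-]|//].
  by split; [exact: oner_neq0 | exact: dlog1].
by split; [exact: mulf_neq0 | exact: dlogM].
Qed.

Lemma dlogXz x (m : int) : x != 0 -> dlog (x ^ m) = m%:~R * dlog x.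
Proof.
move=> x_neq0; have dlogXn n : dlog (x ^+ n) = n%:R * dlog x.
  rewrite -[in LHS](card_ord n) -prodr_const dlog_prod //.
  by rewrite sumr_const card_ord mulr_natl.
case: m => n; first exact: dlogXn.
by rewrite NegzE -exprnN dlogV dlogXn mulrNz mulNr.
Qed.

End LogarithmicDerivative.
Arguments dlog {L} D x.

Lemma dlog_term_monomial (R : realType) (r : nat) (t : hyp_term R r)
    (w : 'rV[CC R]_r) (D : {additive CC R -> CC R}) (i : 'I_r.+1) :
  is_derivation D -> balanced t -> (~` arrangement t) w ->
  dlog D (term_monomial t w i) =
  log_monomial t (dlog D \o tC t) (fun j => dlog D (dehom (tA t j) w)) i.
Proof.
move=> D_derivation [C_neq0 _ _ _] /notin_arrangementP form0.
have factor j : dehom (tA t j) w ^ (teps t j * vcoef i (tA t j)) != 0 /\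
    dlog D (dehom (tA t j) w ^ (teps t j * vcoef i (tA t j))) =
    (teps t j * vcoef i (tA t j))%:~R * dlog D (dehom (tA t j) w).
  have [/form0 ->|A_neq0] := eqVneq (dehom (tA t j) w) 0; last first.
    by split; [exact: expfz_neq0 | exact: dlogXz].
  by rewrite /vcoef mxE mulr0 expr0z oner_neq0 dlog1 // mul0r.
rewrite dlogM //; last by apply/prodf_neq0 => j _; exact: (factor j).1.
congr (_ + _); rewrite dlog_prod //; last by move=> j; exact: (factor j).1.
by apply: eq_bigr => j _; exact: (factor j).2.
Qed.

Lemma CV_algebraic (R : realType) (r : nat) (t : hyp_term R r) :
  balanced t -> forall z, CV t z -> algebraic_number z.
Proof.
move=> bal z; rewrite CV_term_monomial // => -[w Xw zE].
apply: contrapT => z_transc.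
have [D [D_derivation Dz D_alg]] :=
  exists_derivation_transcendental (@pchar_num _) z_transc.
have w_notin := variational_notin_arrangement bal Xw.
have [C_neq0 C_alg _ _] := bal.
pose dlogC := dlog D \o tC t.
pose dlogA j := dlog D (dehom (tA t j) w).
have dlogC0 i : dlogC i = 0.
  by rewrite /dlogC /= /dlog (D_alg _ (C_alg i)) mul0r.
have dlog_monomial i :
    dlog D (term_monomial t w i) = log_monomial t dlogC dlogA i.
  exact: dlog_term_monomial.
have euler : \sum_i homog w 0 i * log_monomial t dlogC dlogA i = 0.
  rewrite sum_log_monomial big1 ?add0r => [|i _]; last by rewrite dlogC0 mulr0.
  transitivity (D (\sum_j (teps t j)%:~R * dehom (tA t j) w)).
    rewrite raddf_sum; apply: eq_bigr => j _.
    by rewrite -dehom_form_eval -mulrA dlogK !mulrzl raddfMz.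
  under eq_bigr do rewrite dehom_form_eval.
  by rewrite balanced_form_eval // raddf0.
have dlog_M0 : dlog D (term_monomial t w ord0) = 0.
  move: euler; rewrite big_ord_recl homog_ord0 mul1r dlog_monomial.
  rewrite big1 ?addr0 // => i _.
  by rewrite -dlog_monomial (Xw i : term_monomial _ _ _ = 1) dlog1 // mulr0.
have : D z = 0 by rewrite -[LHS]dlogK -zE dlogV // dlog_M0 oppr0 mulr0.
by move/eqP; rewrite Dz oner_eq0.
Qed.

(** * Definable sets and finiteness of the critical values *)

Section DefinableSets.
Context {F : closedFieldType}.
Implicit Types (A B : set F) (f : GRing.formula F) (u : GRing.term F).
Implicit Types (g h : seq F -> F) (P Q : seq F -> Prop).

Definition finite_or_cofinite A : Prop := finite_set A \/ cofinite_set A.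

Lemma finite_or_cofiniteC A : finite_or_cofinite A -> finite_or_cofinite (~` A).
Proof. by case; [right; rewrite setCK | left]. Qed.

Lemma finite_or_cofiniteU A B :
  finite_or_cofinite A -> finite_or_cofinite B -> finite_or_cofinite (A `|` B).
Proof.
case=> [fA|cA]; last by right; exact: cofinite_setUl.
by case=> [fB|cB]; [left; rewrite finite_setU | right; exact: cofinite_setUr].
Qed.

Lemma finite_or_cofiniteI A B :
  finite_or_cofinite A -> finite_or_cofinite B -> finite_or_cofinite (A `&` B).
Proof.
move=> fA fB; rewrite -(setCK (A `&` B)) setCI.
by apply/finite_or_cofiniteC/finite_or_cofiniteU; exact: finite_or_cofiniteC.
Qed.

Lemma finite_roots (p : {poly F}) : p != 0 -> finite_set [set z | root p z].
Proof.
move=> p_neq0; have [s pE] := closed_field_poly_normal p.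
apply: sub_finite_set (finite_seq s) => z /=.
by rewrite pE rootZ ?lead_coef_eq0 // root_prod_XsubC.
Qed.

Lemma finite_or_cofinite_roots (p : {poly F}) :
  finite_or_cofinite [set z | root p z].
Proof.
have [->|p_neq0] := eqVneq p 0; last by left; exact: finite_roots.
right; rewrite (_ : [set z | root 0 z] = setT) ?setCT //.
by apply/seteqP; split=> z //= _; exact: root0.
Qed.

Lemma finite_or_cofinite_qf_eval f : GRing.qf_form f -> GRing.rformula f ->
  finite_or_cofinite [set z | GRing.qf_eval [:: z] f].
Proof.
elim: f => //=.
- by case=> _ _; [right | left]; apply: sub_finite_set (finite_set0 F) => z //=.
- move=> u1 u2 _ /andP[u1_ring u2_ring]; pose poly_of u :=
    ClosedFieldQE.eval_poly [::] (ClosedFieldQE.abstrX 0 u) : {poly F}.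
  have poly_ofE u z : GRing.rterm u -> GRing.eval [:: z] u = (poly_of u).[z].
    by move=> u_ring; rewrite ClosedFieldQE.abstrXP.
  under eq_set do rewrite !poly_ofE // -subr_eq0 -hornerN -hornerD.
  exact: finite_or_cofinite_roots.
- move=> f1 IH1 f2 IH2 /andP[q1 q2] /andP[r1 r2].
  rewrite (set_andb (fun z => GRing.qf_eval [:: z] f1)).
  by apply: finite_or_cofiniteI; [exact: IH1 | exact: IH2].
- move=> f1 IH1 f2 IH2 /andP[q1 q2] /andP[r1 r2].
  rewrite (set_orb (fun z => GRing.qf_eval [:: z] f1)).
  by apply: finite_or_cofiniteU; [exact: IH1 | exact: IH2].
- move=> f1 IH1 f2 IH2 /andP[q1 q2] /andP[r1 r2].
  rewrite (_ : [set z | _] = ~` [set z | GRing.qf_eval [:: z] f1] `|`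
      [set z | GRing.qf_eval [:: z] f2]).
    apply: finite_or_cofiniteU; last exact: IH2.
    exact/finite_or_cofiniteC/IH1.
  apply/seteqP; split=> z /=; rewrite implybE.
    by move=> /orP[/negP|]; [left | right].
  by case=> [/negP ->|->] //; rewrite orbT.
- move=> f1 IH1 q1 r1.
  rewrite (_ : [set z | _] = ~` [set z | GRing.qf_eval [:: z] f1]).
    exact/finite_or_cofiniteC/IH1.
  by apply/seteqP; split=> z /= /negP.
Qed.

Lemma finite_or_cofinite_holds f :
  finite_or_cofinite [set z | GRing.holds [:: z] f].
Proof.
have f_ring := GRing.to_rform_rformula f.
have elim_wf := @ClosedFieldQE.wf_ex_elim F.
have elim_ok := ClosedFieldQE.holds_ex_elim (@GRing.solve_monicpoly F).
have qfP z := GRing.quantifier_elim_rformP elim_wf elim_ok [:: z] f_ring.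
have /andP[qf_form qf_ring] := GRing.quantifier_elim_wf elim_wf f_ring.
rewrite (_ : [set z | _] = [set z | GRing.qf_eval [:: z]
    (GRing.quantifier_elim (@ClosedFieldQE.ex_elim F) (GRing.to_rform f))]).
  exact: finite_or_cofinite_qf_eval.
by apply/seteqP; split=> z /= => [/GRing.to_rformP/qfP|/qfP/GRing.to_rformP].
Qed.

Definition definable_fun g : Prop :=
  exists u : GRing.term F, forall e, GRing.eval e u = g e.

Definition definable P : Prop :=
  exists f : GRing.formula F, forall e, GRing.holds e f <-> P e.

Lemma definable_fun_nth i : definable_fun (fun e => e`_i).
Proof. by exists (GRing.Var _ i). Qed.

Lemma definable_fun_cst (c : F) : definable_fun (fun=> c).
Proof. by exists (GRing.Const c). Qed.

Lemma definable_funD g h :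
  definable_fun g -> definable_fun h -> definable_fun (fun e => g e + h e).
Proof.
by move=> [u uE] [v vE]; exists (GRing.Add u v) => e /=; rewrite uE vE.
Qed.

Lemma definable_funM g h :
  definable_fun g -> definable_fun h -> definable_fun (fun e => g e * h e).
Proof.
by move=> [u uE] [v vE]; exists (GRing.Mul u v) => e /=; rewrite uE vE.
Qed.

Lemma definable_funV g : definable_fun g -> definable_fun (fun e => (g e)^-1).
Proof. by move=> [u uE]; exists (GRing.Inv u) => e /=; rewrite uE. Qed.

Lemma definable_funXn g n :
  definable_fun g -> definable_fun (fun e => g e ^+ n).
Proof. by move=> [u uE]; exists (GRing.Exp u n) => e /=; rewrite uE. Qed.

Lemma definable_funXz g (m : int) :
  definable_fun g -> definable_fun (fun e => g e ^ m).
Proof.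
by case: m => n g_def; [|apply: definable_funV]; exact: definable_funXn.
Qed.

Lemma definable_fun_sum (I : finType) (g : I -> seq F -> F) :
  (forall i, definable_fun (g i)) -> definable_fun (fun e => \sum_i g i e).
Proof.
move=> g_def; rewrite -fct_sumE; elim/big_ind: _ => //.
  exact: definable_fun_cst.
exact: definable_funD.
Qed.

Lemma definable_fun_prod (I : finType) (g : I -> seq F -> F) :
  (forall i, definable_fun (g i)) -> definable_fun (fun e => \prod_i g i e).
Proof.
move=> g_def; rewrite -fct_prodE; elim/big_ind: _ => //.
  exact: definable_fun_cst.
exact: definable_funM.
Qed.

Lemma definable_eq g h :
  definable_fun g -> definable_fun h -> definable (fun e => g e = h e).
Proof.
by move=> [u uE] [v vE]; exists (GRing.Equal u v) => e /=; rewrite uE vE.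
Qed.

Lemma definable_and P Q :
  definable P -> definable Q -> definable (fun e => P e /\ Q e).
Proof.
by move=> [f fP] [f' fQ]; exists (GRing.And f f') => e /=; rewrite fP fQ.
Qed.

Lemma definable_forall (I : finType) (P : I -> seq F -> Prop) :
  (forall i, definable (P i)) -> definable (fun e => forall i, P i e).
Proof.
move=> /choice[f fP].
pose conjunction := foldr (fun i => GRing.And (f i)) (GRing.Bool true).
exists (conjunction (enum I)) => e.
suff -> : GRing.holds e (conjunction (enum I)) <->
    forall i, i \in enum I -> P i e.
  by split=> Pe i => [|_]; apply: Pe; rewrite mem_enum.
elim: (enum I) => [|i s IHs] //=; rewrite fP IHs; split=> [[Pi Ps] j|Ps].
  by rewrite inE => /predU1P[->|/Ps].
by split=> [|j js]; apply: Ps; rewrite inE ?eqxx // js orbT.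
Qed.

Lemma finite_or_cofinite_exists_row r (P : F -> 'rV[F]_r -> Prop) :
  definable (fun e => P e`_0 (\row_(i < r) e`_i.+1)) ->
  finite_or_cofinite [set z | exists w, P z w].
Proof.
move=> [f fP].
rewrite (_ : mkset _ =
    [set z | GRing.holds [:: z] (foldr GRing.Exists f (iota 1 r))]).
  exact: finite_or_cofinite_holds.
apply/seteqP.
split=> z /= => [[w Pzw]|/GRing.foldExistsP[e ez /fP Pe]]; last first.
  exists (\row_(i < r) e`_i.+1); rewrite (_ : z = e`_0) //.
  by have := ez 0; rewrite inE mem_iota => /(_ isT).
apply/GRing.foldExistsP; pose e := z :: [seq w 0 i | i : 'I_r].
have e_nth (i : 'I_r) : e`_i.+1 = w 0 i.
  by rewrite /= (nth_map i) ?size_enum_ord // nth_ord_enum.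
exists e; last first.
  apply/fP; rewrite (_ : \row__ _ = w) //.
  by apply/rowP => i; rewrite mxE e_nth.
case=> [//|i]; rewrite inE mem_iota /= add1n ltnS => i_ge.
by rewrite /= nth_nil nth_default // size_map size_enum_ord leqNgt.
Qed.

End DefinableSets.

Section Transcendental.
Context {R : realType}.

Lemma countable_algebraic : countable [set z : CC R | algebraic_number z].
Proof.
have -> : [set z : CC R | algebraic_number z] =
    \bigcup_(p in [set p : {poly rat} | p != 0])
      [set z | root (map_poly (ratr : rat -> CC R) p) z].
  by apply/seteqP; split=> z [p p_neq0 pz]; exists p.
apply: bigcup_countable => [|p /= p_neq0]; first exact: countableP.
by apply/finite_set_countable/finite_roots; rewrite map_poly_eq0.
Qed.

Lemma uncountable_CC : ~ countable [set: CC R].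
Proof.
move=> /countable_injP[f f_inj].
have : countable `[0%R, 1%R : R]%classic.
  apply/countable_injP; exists (f \o real_complex R) => x y _ _ /=.
  by move=> /f_inj; rewrite !in_setT => /(_ isT isT) -[].
move/countable_lebesgue_measure0; rewrite lebesgue_measure_itv /= lte_fin ltr01.
by rewrite oppr0 adde0 => /eqP; rewrite eqe oner_eq0.
Qed.

Lemma infinite_transcendental :
  infinite_set [set z : CC R | ~ algebraic_number z].
Proof.
move=> /finite_set_countable transc_countable; apply: uncountable_CC.
rewrite -(setUv [set z : CC R | algebraic_number z]).
rewrite -bigcup2inE; apply: bigcup_countable => [|[|[|n]] //= _].
  exact: countableP.
exact: countable_algebraic.
Qed.

End Transcendental.

Lemma definable_term_monomial (R : realType) (r : nat) (t : hyp_term R r)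
    (i : 'I_r.+1) :
  definable_fun (fun e => term_monomial t (\row_(k < r) e`_k.+1) i).
Proof.
apply: definable_funM; first exact: definable_fun_cst.
apply: definable_fun_prod => j; apply: definable_funXz.
apply: definable_funD; first exact: definable_fun_cst.
apply: definable_fun_sum => k.
apply: definable_funM; first exact: definable_fun_cst.
under eq_fun do rewrite mxE.
exact: definable_fun_nth.
Qed.

Lemma CV_finite (R : realType) (r : nat) (t : hyp_term R r) :
  balanced t -> finite_set (CV t).
Proof.
move=> bal; pose is_value (z : CC R) (w : 'rV[CC R]_r) :=
  variational_solutions t w /\ z = (term_monomial t w ord0)^-1.
have : finite_or_cofinite (CV t).
  rewrite (_ : CV t = [set z | exists w, is_value z w]); last first.
    rewrite CV_term_monomial //.
    by apply/seteqP; split=> z /= [w]; [move=> Xw <- | case=> Xw ->]; exists w.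
  apply: finite_or_cofinite_exists_row; apply: definable_and.
    apply: definable_forall => i; apply: definable_eq (definable_fun_cst 1).
    exact: definable_term_monomial.
  apply: definable_eq; first exact: definable_fun_nth.
  exact/definable_funV/definable_term_monomial.
case=> // CV_cofinite; case: (@infinite_transcendental R).
by apply: sub_finite_set CV_cofinite => z z_transc /(CV_algebraic bal).
Qed.

(** * Faces of the Newton polytope *)

Lemma dot_affine (F : comPzRingType) (r : nat) (a b : F) (c u v : 'rV[F]_r) :
  \sum_i c 0 i * (a *: u + b *: v) 0 i =
  a * (\sum_i c 0 i * u 0 i) + b * (\sum_i c 0 i * v 0 i).
Proof.
by rewrite !mulr_sumr -big_split; apply: eq_bigr => i _; rewrite !mxE /=; ring.
Qed.

Section Faces.
Context {R : realType} {r : nat}.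
Variable t : hyp_term R r.
Implicit Types (u v w : 'rV[R]_r) (D : set 'rV[R]_r) (j : 'I_(tJ t)).

Local Notation P := (newton_polytope t).

Lemma face_sub_newton_polytope D : is_face P D -> D `<=` P.
Proof. by move=> [_ [c [b [_ ->]]]] w []. Qed.

Lemma face_convex D (a b : R) u v : is_face P D -> 0 <= a -> 0 <= b ->
  a + b = 1 -> D u -> D v -> D (a *: u + b *: v).
Proof.
move=> [_ [c [m [_ ->]]]] a_ge0 b_ge0 ab1 [/= Pu fu] [/= Pv fv].
split; last by rewrite /= dot_affine fu fv -mulrDl ab1 mul1r.
by move=> j; rewrite dehom_affine // addr_ge0 // mulr_ge0.
Qed.

Definition active_forms D : {set 'I_(tJ t)} :=
  [set j | `[< forall w, D w -> dehom (tA t j) w = 0 >]]%SET.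

Lemma active_formsP D j :
  reflect (forall w, D w -> dehom (tA t j) w = 0) (j \in active_forms D).
Proof. by rewrite inE; exact: asboolP. Qed.

Lemma face_interior_point D : is_face P D ->
  exists2 w, D w & forall j, j \notin active_forms D -> 0 < dehom (tA t j) w.
Proof.
move=> D_face; have DP := face_sub_newton_polytope D_face.
suff [w Dw w_pos] : exists2 w, D w & forall j, j \in enum 'I_(tJ t) ->
    j \notin active_forms D -> 0 < dehom (tA t j) w.
  by exists w => // j; apply: w_pos; rewrite mem_enum.
elim: (enum _) => [|j s [w Dw w_pos]].
  by case: (D_face) => -[w Dw] _; exists w.
have [j_active|/active_formsP] := boolP (j \in active_forms D).
  by exists w => // k; rewrite inE => /predU1P[->|/w_pos //]; rewrite j_active.
move=> /existsNP[v /not_implyP[Dv /eqP vj]].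
have half_gt0 : 0 < 2^-1 :> R by rewrite invr_gt0.
have half_ge0 := ltW half_gt0.
have half2 : 2^-1 + 2^-1 = 1 :> R by rewrite -[2^-1]mul1r -splitr.
exists (2^-1 *: v + 2^-1 *: w); first exact: face_convex.
have vj_pos : 0 < dehom (tA t j) v by rewrite lt_neqAle eq_sym vj; exact: DP.
move=> k; rewrite dehom_affine // inE => /predU1P[-> _|ks k_inactive].
  by rewrite ltr_pwDl ?mulr_gt0 // mulr_ge0 //; exact: DP.
by rewrite ltr_wpDl ?mulr_gt0 ?w_pos // mulr_ge0 //; exact: DP.
Qed.

Lemma newton_polytope_prolong w0 w : P w0 -> P w ->
  (forall j, dehom (tA t j) w != 0 -> 0 < dehom (tA t j) w0) ->
  exists2 e, 0 < e & P ((1 + e) *: w0 + (- e) *: w).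
Proof.
move=> Pw0 Pw w0_pos.
pose a j := dehom (tA t j) w0; pose b j := dehom (tA t j) w.
have b_pos j : b j != 0 -> 0 < b j by rewrite lt_neqAle eq_sym => ->; exact: Pw.
pose e := \big[Num.min/1]_(j | b j != 0) (a j / b j).
have e_gt0 : 0 < e.
  by apply: lt_bigmin => // j bj; rewrite divr_gt0 ?w0_pos ?b_pos.
exists e => // j; rewrite dehom_affine ?addrK // mulNr subr_ge0 -/(a j) -/(b j).
have a_ge0 : 0 <= a j := Pw0 j.
apply: (@le_trans _ _ (a j)); last first.
  by rewrite mulrDl mul1r lerDl mulr_ge0 // ltW.
have [->|bj_neq0] := eqVneq (b j) 0; first by rewrite mulr0.
by rewrite -ler_pdivlMr ?b_pos //; exact: bigmin_le_cond.
Qed.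

(* If w satisfies the active equations of D and w0 is interior to D, then the
   segment from w to w0 can be prolonged inside P, so the supporting functional
   of D cannot be smaller at w than at w0. *)
Lemma face_active_forms D : is_face P D ->
  D = P `&` [set w | forall j, j \in active_forms D -> dehom (tA t j) w = 0].
Proof.
move=> D_face; have [w0 Dw0 w0_pos] := face_interior_point D_face.
apply/seteqP; split=> w.
  move=> Dw; split; first exact: face_sub_newton_polytope Dw.
  by move=> j /active_formsP; exact.
move=> [/= Pw w_active]; have Pw0 := face_sub_newton_polytope D_face Dw0.
have [|e e_gt0 Pe] := newton_polytope_prolong Pw0 Pw.
  by move=> j wj; apply: w0_pos; apply: contra_neqN wj; exact: w_active.
case: D_face Dw0 => _ [c [b [f_le ->]]] [_ /= fw0]; split=> //.
have := f_le _ Pe; rewrite dot_affine fw0 => fe.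
by apply/eqP; rewrite /= eq_le f_le //= -(ler_pM2l e_gt0); move: fe; lra.
Qed.

Lemma finite_faces : finite_set [set D | is_face P D].
Proof.
apply: (@sub_finite_set _ _ ((fun I : {set 'I_(tJ t)} => P `&`
    [set w | forall j, j \in I -> dehom (tA t j) w = 0]) @` setT)).
  by move=> D /face_active_forms DE; exists (active_forms D).
exact/finite_image/finite_finset.
Qed.

End Faces.

(** * Dependence on the parametrization of a face *)

Lemma prod_exprz_mulmx (F : fieldType) (m n p : nat) (x : 'I_n -> F)
    (U : 'M[int]_(m, n)) (V : 'M[int]_(p, m)) (i : 'I_p) :
  (forall l, x l != 0) ->
  \prod_k (\prod_l x l ^ U k l) ^ V i k = \prod_l x l ^ (V *m U) i l.
Proof.
move=> x_neq0; under eq_bigr => k _.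
  rewrite (big_morph (fun y => y ^ V i k)
    (fun y z => expfzMl y z _) (exp1rz _ _)).
  under eq_bigr do rewrite exprz_exp mulrC.
  over.
rewrite exchange_big; apply: eq_bigr => l _; rewrite mxE.
by rewrite (big_morph _ (fun a b => expfzDr a b (x_neq0 l)) (expr0z _)).
Qed.

Lemma prod_exprz1mx (F : fieldType) (n : nat) (x : 'I_n -> F) (i : 'I_n) :
  \prod_l x l ^ (1%:M : 'M[int]_n) i l = x i.
Proof.
rewrite (bigD1 i) //= mxE eqxx expr1z big1 ?mulr1 // => l li.
by rewrite mxE eq_sym (negPf li) expr0z.
Qed.

Section ChangeOfParametrization.
Context {R : realType}.
Implicit Types r s q : nat.

Lemma restrict_restrict q r s (t : hyp_term R r)
    (phi : 'M[int]_(s.+1, r.+1)) (U : 'M[int]_(q.+1, s.+1)) : balanced t ->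
  restrict_term (restrict_term t phi) U = restrict_term t (U *m phi).
Proof.
case=> C_neq0 _ _ _; rewrite /restrict_term /=; congr HypTerm.
  by apply/funext => l; exact: prod_exprz_mulmx.
by apply/funext => j; rewrite trmx_mul mulmxA.
Qed.

Lemma CV_restrict_sub s q (t : hyp_term R s)
    (U : 'M[int]_(q.+1, s.+1)) (V : 'M[int]_(s.+1, q.+1)) : balanced t ->
  V *m U = 1%:M -> 0 < U ord0 ord0 ->
  (forall l : 'I_q, U (lift ord0 l) ord0 = 0) ->
  V ord0 ord0 = 1 -> (forall l : 'I_s, V (lift ord0 l) ord0 = 0) ->
  CV (restrict_term t U) `<=` CV t.
Proof.
move=> bal VU U00_gt0 U_l0 V00 V_l0 z.
have U_bal := balanced_restrict U bal.
have U00_neq0 : (U ord0 ord0)%:~R != 0 :> CC R by rewrite intr_eq0 gt_eqF.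
rewrite !CV_term_monomial // => -[w Xw <-]; pose v := affine_param U w.
have v_notin : (~` arrangement t) v.
  apply/notin_arrangementP => j Av0.
  have /notin_arrangementP/(_ j) := variational_notin_arrangement U_bal Xw.
  rewrite /= dehom_restrict // -/v Av0 mulr0 => /(_ erefl) AU0.
  by rewrite -[tA t j]mulmx1 -trmx1 -VU trmx_mul mulmxA AU0 mul0mx.
have M_neq0 i := term_monomial_neq0 i bal v_notin.
have M_v i : term_monomial t v i =
    term_monomial (restrict_term t U) w ord0 ^ V i ord0.
  rewrite -[LHS](prod_exprz1mx (term_monomial t v)) -VU -prod_exprz_mulmx //.
  under eq_bigr do rewrite -term_monomial_restrict //.
  rewrite big_ord_recl big1 ?mulr1 // => l _.
  by rewrite (Xw l : term_monomial _ _ _ = 1) exp1rz.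
exists v => [i|]; last by rewrite M_v V00 expr1z.
by rewrite -[LHS]/(term_monomial t v _) M_v V_l0 expr0z.
Qed.

Lemma face_param_row r s (D : set 'rV[R]_r) (phi : 'M[int]_(s.+1, r.+1)) :
  face_param D phi -> forall l, cone_span D (map_mx intr (row l phi)).
Proof.
by case=> _ _ _ span l; apply/span; exists (delta_mx 0 l); rewrite rowE.
Qed.

Lemma face_param_transition r s q (D : set 'rV[R]_r)
    (phi : 'M[int]_(s.+1, r.+1)) (psi : 'M[int]_(q.+1, r.+1)) :
  face_param D phi -> face_param D psi ->
  exists U : 'M[int]_(s.+1, q.+1), [/\ phi = U *m psi,
    phi ord0 ord0 = U ord0 ord0 * psi ord0 ord0 &
    forall l : 'I_s, U (lift ord0 l) ord0 = 0].
Proof.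
move=> phiD psiD; have [psi00_gt0 psi_l0 _ psi_span] := psiD.
have /choice[x xE] l : exists x, row l phi = x *m psi.
  exact/psi_span/(face_param_row phiD).
pose U := \matrix_l x l.
have phiE : phi = U *m psi by apply/row_matrixP => l; rewrite row_mul rowK.
have col0 l : phi l ord0 = U l ord0 * psi ord0 ord0.
  rewrite {1}phiE mxE big_ord_recl big1 ?addr0 // => k _.
  by rewrite psi_l0 mulr0.
exists U; split=> // l; case: phiD => _ phi_l0 _ _.
have /esym/eqP := col0 (lift ord0 l).
by rewrite phi_l0 mulf_eq0 (gt_eqF psi00_gt0) orbF => /eqP.
Qed.

Lemma CV_face_param r s q (t : hyp_term R r) (D : set 'rV[R]_r)
    (phi : 'M[int]_(s.+1, r.+1)) (psi : 'M[int]_(q.+1, r.+1)) : balanced t ->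
  face_param D phi -> face_param D psi ->
  CV (restrict_term t phi) `<=` CV (restrict_term t psi).
Proof.
move=> bal phiD psiD.
have [U [phiE phi00 U_l0]] := face_param_transition phiD psiD.
have [V [psiE psi00 V_l0]] := face_param_transition psiD phiD.
have [phi00_gt0 _ _ _] := phiD; have [psi00_gt0 _ psi_inj _] := psiD.
have VU : V *m U = 1%:M.
  apply/row_matrixP => l; apply: psi_inj.
  by rewrite /= -!row_mul -mulmxA -phiE -psiE mul1mx.
have U00_gt0 : 0 < U ord0 ord0 by move: phi00_gt0; rewrite phi00 pmulr_lgt0.
have V00_gt0 : 0 < V ord0 ord0 by move: psi00_gt0; rewrite psi00 pmulr_lgt0.
have V00 : V ord0 ord0 = 1 by nia.
rewrite phiE -restrict_restrict //.
by apply: (CV_restrict_sub _ VU) => //; exact: balanced_restrict.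
Qed.

Definition face_values r (t : hyp_term R r) (D : set 'rV[R]_r) : set (CC R) :=
  [set z | exists (s : nat) (phi : 'M[int]_(s.+1, r.+1)),
    face_param D phi /\ CV (restrict_term t phi) z].

Lemma face_values_finite r (t : hyp_term R r) D : balanced t ->
  finite_set (face_values t D).
Proof.
move=> bal; have [[s [phi phiD]]|no_param] :=
    pselect (exists (s : nat) (phi : 'M[int]_(s.+1, r.+1)), face_param D phi).
  apply: (sub_finite_set _ (CV_finite (balanced_restrict phi bal))).
  by move=> z [q [psi [psiD]]]; exact: CV_face_param bal psiD phiD _.
apply: sub_finite_set (finite_set0 _) => z [s [phi [phiD _]]].
by apply: no_param; exists s, phi.
Qed.

Lemma S_set_finite r (t : hyp_term R r) : balanced t -> finite_set (S_set t).
Proof.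
move=> bal; rewrite /S_set finite_setU; split; first exact: finite_set1.
apply: (@sub_finite_set _ _
  (\bigcup_(D in [set D | is_face (newton_polytope t) D]) face_values t D)).
  by move=> z [D [s [phi [D_face phiD zCV]]]]; exists D => //; exists s, phi.
apply: bigcup_finite => [|D _]; first exact: finite_faces.
exact: face_values_finite.
Qed.

Lemma S_set_algebraic r (t : hyp_term R r) : balanced t ->
  forall z, S_set t z -> algebraic_number z.
Proof.
move=> bal z [->|[D [s [phi [_ _]]]]]; first exact: algebraic0.
exact/CV_algebraic/balanced_restrict.
Qed.

End ChangeOfParametrization.

(** * Number fields *)

Section SimpleExtensions.
Context {F L : fieldType} {iota : {rmorphism F -> L}}.

Definition simple_extension (z : L) : set L :=
  range (fun q : {poly F} => (map_poly iota q).[z]).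

Lemma simple_extension_subfield (z : L) :
  algebraicOver iota z -> is_subfield (simple_extension z).
Proof.
case=> p p_neq0 pz.
have hornerE q : (map_poly iota q).[z] = subfx_inj (subfx_eval iota z p q).
  by rewrite subfx_inj_eval.
split=> [|_ _ [q _ <-] [q' _ <-]|_ _ [q _ <-] [q' _ <-]].
- by exists 1 => //; rewrite rmorph1 hornerC.
- by exists (q - q') => //; rewrite rmorphB hornerD hornerN.
- have [d dE] := subfxE (subfx_eval iota z p q / subfx_eval iota z p q').
  by exists d => //; rewrite !hornerE -dE fmorph_div.
Qed.

Lemma simple_extension_sub (y z : L) : simple_extension z y ->
  simple_extension y `<=` simple_extension z.
Proof.
move=> [g _ <-] _ [q _ <-]; exists (q \Po g) => //.
by rewrite map_comp_poly horner_comp.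
Qed.

Lemma simple_extension_span (z : L) (p : {poly F}) (x : L) :
  p != 0 -> root (map_poly iota p) z -> simple_extension z x ->
  exists c : 'I_(size p) -> F, x = \sum_i iota (c i) * z ^+ i.
Proof.
move=> p_neq0 /rootP pz [q _ <-]; exists (fun i => (q %% p)`_i).
transitivity (map_poly iota (q %% p)).[z].
  rewrite {1}(divp_eq q p) (rmorphD (map_poly iota)) (rmorphM (map_poly iota)).
  by rewrite hornerD hornerM pz mulr0 add0r.
rewrite (@horner_coef_wide _ (size p)).
  by apply: eq_bigr => i _; rewrite coef_map.
by rewrite (leq_trans (size_poly _ _)) // ltnW // ltn_modp.
Qed.

Lemma algebraic_primitive_element (s : seq L) : [pchar F] =i pred0 ->
  (forall x, x \in s -> algebraicOver iota x) ->
  exists2 z, algebraicOver iota z & forall x, x \in s -> simple_extension z x.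
Proof.
move=> pchar0; elim: s => [|x s IHs] s_alg.
  by exists 0; first exact: algebraic0.
have [|z z_alg s_ext] := IHs.
  by move=> y ys; apply: s_alg; rewrite inE ys orbT.
have x_alg : algebraicOver iota x by apply: s_alg; rewrite mem_head.
have [p p_neq0 pz] := z_alg; have [q q_neq0 qx] := x_alg.
have [n [[gz zE] [gx xE]]] := pchar0_PET p_neq0 pz q_neq0 qx pchar0.
exists (x *+ n - z).
  apply: algebraic_sub z_alg; rewrite -mulr_natr; apply: algebraic_mul => //.
  by rewrite -(rmorph_nat iota); exact: algebraic_id.
move=> y; rewrite inE => /predU1P[->|/s_ext]; first by exists gx.
by apply: simple_extension_sub; exists gz.
Qed.

End SimpleExtensions.
Arguments simple_extension {F L} iota z.

Lemma generated_field_subfield (F : fieldType) (S : set F) :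
  is_subfield (generated_field S).
Proof.
split=> [K [] //|x y Sx Sy K KF SK|x y Sx Sy K KF SK]; case: (KF) => _ KB KV.
  by apply: KB; [exact: Sx | exact: Sy].
by apply: KV; [exact: Sx | exact: Sy].
Qed.

Lemma number_field_generated (R : realType) (S : set (CC R)) : finite_set S ->
  (forall z, S z -> algebraic_number z) -> number_field (generated_field S).
Proof.
move=> /finite_seqP[s ->] s_alg; split; first exact: generated_field_subfield.
have [z z_alg s_ext] := algebraic_primitive_element (@pchar_num rat) s_alg.
have [p p_neq0 pz] := z_alg.
exists (size p), (fun i : 'I_(size p) => z ^+ i) => x x_gen.
apply: simple_extension_span p_neq0 pz _.
by apply: x_gen; [exact: simple_extension_subfield | exact: s_ext].
Qed.

Unset Implicit Arguments.

Theorem theorem2p3 (R : realType) (r : nat) (t : hyp_term R r)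
    (t_balanced : balanced t)
    (P_compact : compact (newton_polytope t))
    (P_interior : interior (newton_polytope t) !=set0) :
  (forall (E : topologicalType) (p : E -> 'rV[CC R]_r),
    universal_abelian_cover (~` arrangement t) p ->
    forall lA : 'I_(tJ t) -> E -> CC R, log_branches t p lA ->
    (* (a) *)
    p @^-1` variational_solutions t =
      [set e | exists2 lC, log_constants t lC &
                 critical_point p (lifted_potential t p lC lA) e] /\
    (* (b) *)
    (forall lC e, log_constants t lC ->
      critical_point p (lifted_potential t p lC lA) e ->
      cexp (- lifted_potential t p lC lA e) =
        (tC t ord0)^-1 *
        \prod_j dehom (tA t j) (p e) ^ (- (teps t j * vcoef ord0 (tA t j))) /\
      (tC t ord0)^-1 *
        \prod_j dehom (tA t j) (p e) ^ (- (teps t j * vcoef ord0 (tA t j))) =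
        (tC t ord0)^-1 *
        \prod_(j | dehom (tA t j) (p e) != 0)
          dehom (tA t j) (p e) ^ (- (teps t j * vcoef ord0 (tA t j)))) /\
    CV t =
      [set z | exists lC e,
        [/\ log_constants t lC,
            critical_point p (lifted_potential t p lC lA) e &
            z = cexp (- lifted_potential t p lC lA e)]])
  /\
  (* (c) *)
  (forall (D : set 'rV[R]_r) (s : nat) (phi : 'M[int]_(s.+1, r.+1)),
    is_face (newton_polytope t) D -> face_param D phi ->
    forall lC, log_constants t lC ->
    log_constants (restrict_term t phi) (restrict_logs phi lC) /\
    forall (E : topologicalType) (p : E -> 'rV[CC R]_s),
      universal_abelian_cover (~` arrangement (restrict_term t phi)) p ->
      potential_branches (restrict_term t phi) p (restrict_logs phi lC) =
      [set (fun e => (phi ord0 ord0)%:~R * V e)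
        | V in potential_branches t (affine_param phi \o p) lC])
  /\
  (* (d) *)
  [/\ finite_set (S_set t),
      forall z, S_set t z -> algebraic_number z &
      number_field (generated_field (S_set t))].
Proof.
split; [|split].
- move=> E p [[p_cover _ _ _] _] lA lA_branches; split; [|split].
  + exact: variational_critical.
  + move=> lC e lCt e_crit; rewrite -term_monomialV.
    rewrite (critical_valueE (@covering_notin_arrangement _ _ _ _ _ p_cover e)).
    by rewrite (cexp_critical_value _ p_cover lA_branches lCt e_crit).
  + exact: CV_critical_values.
- move=> D s phi _ [phi00_gt0 phi_l0 _ _] lC lCt; split=> [|E p _].
    exact: restrict_log_constants.
  exact: potential_branches_restrict.
- split; [exact: S_set_finite | exact: S_set_algebraic |].
  apply: number_field_generated; first exact: S_set_finite.
  exact: S_set_algebraic.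
Qed.
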